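(* Let $r\ge 2$. For every eventually periodic map $T\in\mathrm{ITM}(r)$, there exists an arbitrarily small perturbation $\tilde T\in\mathrm{ITM}(r)$ of $T$ that is of finite type and satisfies the ACC and Matching conditions. (That is, every neighbourhood of $T$ in $\mathrm{ITM}(r)$ contains such a $\tilde T$.)
   Context: Let $I=[0,1)$ and $r\ge 2$. The parameter space $\mathrm{ITM}(r)\subset\mathbb{R}^{2r-1}$ is the set of vectors $(\gamma_1,\dots,\gamma_r,\beta_1,\dots,\beta_{r-1})$ with $0=\beta_0<\beta_1<\dots<\beta_{r-1}<\beta_r=1$ and $\gamma_i\in[-\beta_{i-1},1-\beta_i]$ for $1\le i\le r$, with the metric and topology induced from $\mathbb{R}^{2r-1}$. Each such vector is identified with the interval translation map $T\colon I\to I$, $T(x)=x+\gamma_i$ for $x\in[\beta_{i-1},\beta_i)$. Put $X_n=T^n(I)$ and $X=\bigcap_{n\ge 0}X_n$. $T$ is of finite type if $X_{n+1}=X_n$ for some $n$; then $X$ is a finite union of half-open intervals $[x,y)$ on which $T$ is bijective. $T$ is eventually periodic if every $x\in I$ eventually lands on a $T$-periodic point. Signed points: every point $x\in(0,1)$ is split into $x^-<x^+$; one also has $0^+$ and $1^-$. $T$ acts on signed points by one-sided limits: $T(x^+)=(x+\gamma_i)^+$ if $x\in[\beta_{i-1},\beta_i)$, and $T(x^-)=(x+\gamma_i)^-$ if $x\in(\beta_{i-1},\beta_i]$. The critical set is $\mathcal{C}=\{\beta_1^-,\beta_1^+,\dots,\beta_{r-1}^-,\beta_{r-1}^+\}$;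 its elements are called critical points or (signed) discontinuities. The half-open interval $[x,y)$ contains exactly the signed points $x^+$, $y^-$ and $z^\pm$ for $x<z<y$; a signed point belongs to $X$ (for $T$ of finite type) if it belongs to one of the intervals that are the connected components of $X$. An interval component $J$ of $X$ is a connected component of $X$, $J=[x,y)$, with boundary points $x^+$ and $y^-$. Every point $a$ of $J$ returns to $J$; its return time is the least $k\ge 1$ with $T^k(a)\in J$. ''Lands on a critical point before returning to $J$'' means that one of $a,T(a),\dots,T^{k-1}(a)$ is a critical point (time $0$ included). $J$ is dynamically trivial if no point in the interior of $J$ lands on a discontinuity, and dynamically non-trivial otherwise. Ghost preimages and ghost trees: a ghost preimage of a signed discontinuity $\beta_*^{+}$ is a discontinuity $\beta_{**}^-\in\mathcal{C}$ with $T^k(\beta_{**}^-)=\beta_*^-$ for some $k\ge 1$; symmetrically, a ghost preimage of $\beta_*^-$ is a discontinuity $\beta_{**}^+\in\mathcal{C}$ with $T^k(\beta_{**}^+)=\beta_*^+$ for some $k\ge 1$. The ghost tree $\mathcal{GT}(\beta)$ of $\beta\in\mathcal{C}$ has root $\beta$ (level $0$), and its level $n+1$ vertices are all ghost preimages of the discontinuities corresponding to level $n$ vertices, with an edge from each ghost preimage to the discontinuity it is a ghost preimage of. ACC: a finite type $T$ satisfies the ACC condition if (A1) for every interval component $J$ of $X$ and each (signed) point $a\in J$, the orbit of $a$ up to and not including the return time to $J$ contains at most one critical point; (A2) for every dynamically non-trivial interval component $J$ of $X$, none of the boundary points of $J$ lands on a discontinuity up to and not including the return time to $J$; (A3) for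 every discontinuity $\beta\in\mathcal{C}$ with $\beta\notin X$, the ghost tree $\mathcal{GT}(\beta)$ does not contain $\beta$ (at any level $\ge 1$). Matching: a finite type $T$ satisfies the Matching condition if for every dynamically non-trivial interval component $J$ of $X$, exactly one point $a$ in the interior of $J$ lands on a critical point before returning to $J$ (here $a^+$ and $a^-$ count as one point $a$). *)

(* Defs.v *)
From HB Require Import structures.
From mathcomp Require Import all_boot all_order all_algebra.
From mathcomp Require Import all_classical all_reals all_analysis.

Set Implicit Arguments.
Unset Strict Implicit.
Unset Printing Implicit Defensive.

Import Order.TTheory GRing.Theory Num.Theory.
Import numFieldNormedType.Exports.

Local Open Scope classical_set_scope.
Local Open Scope ring_scope.

(* R^(2r-1): the coordinates are gamma_1, ..., gamma_r followed by
   beta_1, ..., beta_(r-1), both numbered from 0 here. *)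
Definition param (R : realType) (r : nat) := 'rV[R]_(r + r.-1).

Definition gam (R : realType) (r : nat) (T : param R r) (i : 'I_r) : R :=
  T ord0 (lshift r.-1 i).

(* beta_k for 0 <= k <= r, with beta_0 = 0 and beta_r = 1. *)
Definition bet (R : realType) (r : nat) (T : param R r) (k : nat) : R :=
  if k is j.+1 then
    if (insub j : option 'I_r.-1) is Some i then T ord0 (rshift r i) else 1
  else 0.

Definition ITM (R : realType) (r : nat) : set (param R r) :=
  [set T | (forall i : 'I_r, bet T i < bet T i.+1) /\
           (forall i : 'I_r, - bet T i <= gam T i <= 1 - bet T i.+1)].

(* The value outside [0, 1) is irrelevant: T maps [0, 1) into itself. *)
Definition itm (R : realType) (r : nat) (T : param R r) (x : R) : R :=
  if [pick i : 'I_r | bet T i <= x < bet T i.+1] is Some i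
  then x + gam T i else x.

Definition Xn (R : realType) (r : nat) (T : param R r) (n : nat) : set R :=
  iter n (itm T) @` [set x | 0 <= x < 1].

Definition Xlim (R : realType) (r : nat) (T : param R r) : set R :=
  \bigcap_n Xn T n.

Definition finite_type (R : realType) (r : nat) (T : param R r) : Prop :=
  exists n, Xn T n.+1 = Xn T n.

Definition eventually_periodic (R : realType) (r : nat) (T : param R r) : Prop :=
  forall x : R, 0 <= x < 1 ->
    exists n, exists2 k, (0 < k)%N &
      iter k (itm T) (iter n (itm T) x) = iter n (itm T) x.

(* (x, true) is x^+ and (x, false) is x^-. *)
Definition spoint (R : realType) := (R * bool)%type.

Definition sitm (R : realType) (r : nat) (T : param R r) (a : spoint R) :
    spoint R :=
  if a.2 then (itm T a.1, true)
  else if [pick i : 'I_r | bet T i < a.1 <= bet T i.+1] is Some i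
       then (a.1 + gam T i, false) else a.

Definition critical (R : realType) (r : nat) (T : param R r) :
    set (spoint R) :=
  [set a | exists2 k, (0 < k < r)%N & a.1 = bet T k].

(* Signed points of the half-open interval [x, y). *)
Definition spoints (R : realType) (x y : R) : set (spoint R) :=
  [set a | if a.2 then x <= a.1 < y else x < a.1 <= y].

Definition component (R : realType) (r : nat) (T : param R r) (x y : R) : Prop :=
  exists2 z, Xlim T z & connected_component (Xlim T) z = [set t | x <= t < y].

Definition sXlim (R : realType) (r : nat) (T : param R r) : set (spoint R) :=
  [set a | exists x y, component T x y /\ spoints x y a].

Definition is_return_time (R : realType) (r : nat) (T : param R r)
    (x y : R) (a : spoint R) (k : nat) : Prop :=
  [/\ (0 < k)%N, spoints x y (iter k (sitm T) a) &
      forall j, (0 < j < k)%N -> ~ spoints x y (iter j (sitm T) a)].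

(* If a never returned to [x, y), this would be its whole orbit. *)
Definition orbit_before_return (R : realType) (r : nat) (T : param R r)
    (x y : R) (a : spoint R) : set (spoint R) :=
  [set iter j (sitm T) a |
    j in [set j | forall k, is_return_time T x y a k -> (j < k)%N]].

Definition lands_before_return (R : realType) (r : nat) (T : param R r)
    (x y : R) (a : spoint R) : Prop :=
  exists2 c, orbit_before_return T x y a c & critical T c.

Definition dyn_trivial (R : realType) (r : nat) (T : param R r) (x y : R) :
    Prop :=
  forall (z : R) (s : bool) (n : nat),
    x < z < y -> ~ critical T (iter n (sitm T) (z, s)).

(* a is a ghost preimage of b. *)
Definition ghost_preimage (R : realType) (r : nat) (T : param R r)
    (a b : spoint R) : Prop :=
  [/\ critical T a, critical T b, a.2 = ~~ b.2 &
      exists2 k, (0 < k)%N & iter k (sitm T) a = (b.1, ~~ b.2)].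

(* The discontinuities that occur at level n of the ghost tree of b. *)
Fixpoint ghost_tree_level (R : realType) (r : nat) (T : param R r)
    (b : spoint R) (n : nat) : set (spoint R) :=
  if n is m.+1 then
    [set a | exists2 c, ghost_tree_level T b m c & ghost_preimage T a c]
  else [set b].

Definition A1 (R : realType) (r : nat) (T : param R r) : Prop :=
  forall x y a, component T x y -> spoints x y a ->
    forall c d,
      orbit_before_return T x y a c -> critical T c ->
      orbit_before_return T x y a d -> critical T d -> c = d.

Definition A2 (R : realType) (r : nat) (T : param R r) : Prop :=
  forall x y, component T x y -> ~ dyn_trivial T x y ->
    ~ lands_before_return T x y (x, true) /\
    ~ lands_before_return T x y (y, false).

Definition A3 (R : realType) (r : nat) (T : param R r) : Prop :=
  forall b, critical T b -> ~ sXlim T b ->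
    forall n, ~ ghost_tree_level T b n.+1 b.

Definition ACC (R : realType) (r : nat) (T : param R r) : Prop :=
  [/\ finite_type T, A1 T, A2 T & A3 T].

Definition Matching (R : realType) (r : nat) (T : param R r) : Prop :=
  finite_type T /\
  forall x y, component T x y -> ~ dyn_trivial T x y ->
    exists! z : R,
      x < z < y /\ exists s : bool, lands_before_return T x y (z, s).

(* Main.v *)
(* If the gamma_i are multiples of 1/N, every signed orbit stays in a class
   x + (1/N)Z, hence is finite, and X is the set of periodic points. If moreover
   the differences of distinct breakpoints are irrational, an orbit meets at
   most one beta_i: this already gives A1 and A3.

   A2 and Matching say that in a component of X only one beta_i is hit. Suppose
   beta_i^- and beta_i^+ are both periodic and their orbits, run for N! steps,
   visit every branch equally often. Let the balance at a signed point a be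
   the number of points of the first orbit lying to the right of a, minus the
   same number for the second orbit. It is invariant under push-forward, hence
   supported on periodic points and constant along their orbits; it vanishes at
   beta_l^- and beta_l^+ for l <> i, and does not vanish at beta_i^- or
   beta_i^+. As it jumps only at the points of the two orbits, a component whose
   interior hits beta_i hits no other beta_l.

   If the visit vectors differ, perturb the gammas in a direction along which
   points drift away from beta_i on both sides; by shadowing backward orbits, no
   signed point at beta_i remains periodic, and no non-periodic beta_j becomes
   periodic. So the number of periodic breakpoints drops and the process stops. *)

Require Import Defs.
From mathcomp Require Import all_boot all_order all_algebra.
From mathcomp Require Import all_classical all_reals all_analysis.
From mathcomp Require Import lra ring zify.
Import Order.TTheory GRing.Theory Num.Theory.
Import numFieldNormedType.Exports.

Set Implicit Arguments.
Unset Strict Implicit.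
Unset Printing Implicit Defensive.

Local Open Scope classical_set_scope.
Local Open Scope ring_scope.

(** * Branches and the rational grid *)

Arguments bet : simpl never.

(** A right germ lives just to the right of its base point and a left germ just to its left, hence
    the two half-open conventions. *)
Definition in_branch (R : realType) (r : nat) (T : param R r) (l : 'I_r)
    (a : spoint R) : bool :=
  if a.2 then bet T l <= a.1 < bet T l.+1 else bet T l < a.1 <= bet T l.+1.

Definition valid (R : realType) (a : spoint R) : bool :=
  if a.2 then 0 <= a.1 < 1 else 0 < a.1 <= 1.

Definition bet_increasing (R : realType) (r : nat) (T : param R r) :=
  forall i : 'I_r, bet T i < bet T i.+1.

Lemma bet_first (R : realType) (r : nat) (T : param R r) : bet T 0 = 0.
Proof. by []. Qed.

Lemma bet_last (R : realType) (r : nat) (T : param R r) : (0 < r)%N -> bet T r = 1.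
Proof.
case: r T => // r T _; rewrite /bet insubF //=.
by rewrite ltnn.
Qed.

Lemma bet_lt (R : realType) (r : nat) (T : param R r) (hT : bet_increasing T) (a b : nat) :
  (a < b <= r)%N -> bet T a < bet T b.
Proof.
elim: b => // b IH /andP[]; rewrite ltnS leq_eqVlt => /orP[/eqP -> br|ab br].
  exact: (hT (Ordinal br)).
by apply: lt_trans (hT (Ordinal br)); apply: IH; rewrite ab ltnW.
Qed.

Lemma bet_le (R : realType) (r : nat) (T : param R r) (hT : bet_increasing T) (a b : nat) :
  (a <= b <= r)%N -> bet T a <= bet T b.
Proof.
case/andP; rewrite leq_eqVlt => /orP[/eqP -> //|ab br].
by apply/ltW/bet_lt; rewrite ?ab.
Qed.

Lemma bet_inj (R : realType) (r : nat) (T : param R r) (hT : bet_increasing T) (a b : nat) :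
  (a <= r)%N -> (b <= r)%N -> bet T a = bet T b -> a = b.
Proof.
move=> ar br e; case: (ltngtP a b) => // h; exfalso.
  by have := @bet_lt _ _ _ hT a b; rewrite h br e ltxx => /(_ isT).
by have := @bet_lt _ _ _ hT b a; rewrite h ar e ltxx => /(_ isT).
Qed.

Lemma in_branch_uniq (R : realType) (r : nat) (T : param R r) (hT : bet_increasing T) l m a :
  in_branch T l a -> in_branch T m a -> l = m.
Proof.
wlog: l m / (l <= m)%N.
  move=> W; case: (leqP l m) => [|/ltnW] h; first exact: W.
  by move=> hl hm; apply/esym/W.
rewrite leq_eqVlt => /orP[/eqP/val_inj //|lm].
have : bet T l.+1 <= bet T m by apply: bet_le; rewrite ?lm //= ltnW.
by rewrite /in_branch; case: a.2 => h /andP[h1 h2] /andP[h3 h4]; exfalso; lra.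
Qed.

Lemma in_branch_exists (R : realType) (r : nat) (T : param R r) (hT : bet_increasing T) a :
  (0 < r)%N -> valid a -> exists l, in_branch T l a.
Proof.
move=> r0 va.
(* [P k] says that the germ lies to the left of the k-th breakpoint; the least such [k] is the right
   end of its branch. *)
pose P k := if a.2 then a.1 < bet T k else a.1 <= bet T k.
have exP : exists k, P k.
  exists r; rewrite /P bet_last //; move: va; rewrite /valid.
  by case: a.2 => /andP[].
have [k Pk kmin] := ex_minnP exP.
have kr : (k <= r)%N.
  apply: kmin; rewrite /P bet_last //; move: va; rewrite /valid.
  by case: a.2 => /andP[].
case: k => [|k] in Pk kmin kr *.
  by move: Pk va; rewrite /P /valid bet_first; case: a.2 => h1 /andP[h2 h3]; exfalso; lra.
exists (Ordinal kr); have : ~~ P k by apply/negP => /kmin; rewrite ltnn.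
by move: Pk; rewrite /P /in_branch /=; case: a.2; rewrite -?ltNge -?leNgt => -> ->.
Qed.

Lemma sitmE (R : realType) (r : nat) (T : param R r) (hT : bet_increasing T) l a :
  in_branch T l a -> sitm T a = (a.1 + gam T l, a.2).
Proof.
case: a => x [] ha; rewrite /sitm /= /itm; case: pickP => [m hm|/(_ l)].
- by rewrite (in_branch_uniq hT ha hm).
- by move: ha; rewrite /in_branch /= => ->.
- by rewrite (in_branch_uniq hT ha hm).
- by move: ha; rewrite /in_branch /= => ->.
Qed.

Lemma sitm_sign (R : realType) (r : nat) (T : param R r) a : (sitm T a).2 = a.2.
Proof. by case: a => x [] //=; rewrite /sitm /=; case: pickP. Qed.

Lemma iter_sign (R : realType) (r : nat) (T : param R r) a n :
  (iter n (sitm T) a).2 = a.2.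
Proof. by elim: n => //= n IH; rewrite sitm_sign. Qed.

Lemma iter_sitm_true (R : realType) (r : nat) (T : param R r) n x :
  iter n (sitm T) (x, true) = (iter n (itm T) x, true).
Proof. by elim: n => //= n ->. Qed.

Lemma valid_in_branch (R : realType) (r : nat) (T : param R r) (hT : bet_increasing T) l a :
  in_branch T l a -> valid a.
Proof.
have h0 : 0 <= bet T l by apply: (@bet_le _ _ _ hT 0 l); rewrite leq0n ltnW // ltn_ord.
have h1 : bet T l.+1 <= 1.
  rewrite -(bet_last T (leq_ltn_trans (leq0n l) (ltn_ord l))).
  by apply: bet_le; rewrite ?leqnn ?ltn_ord.
by rewrite /in_branch /valid; case: a.2 => /andP[? ?]; apply/andP; split; lra.
Qed.

Lemma valid_sitm (R : realType) (r : nat) (T : param R r) (hT : ITM T) a :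
  (0 < r)%N -> valid a -> valid (sitm T a).
Proof.
move=> r0 /(in_branch_exists hT.1 r0) [l hl]; rewrite (sitmE hT.1 hl).
have /andP[] := hT.2 l; move: hl; rewrite /in_branch /valid /=.
by case: a.2 => /andP[? ?] ? ?; apply/andP; split; lra.
Qed.

Lemma valid_iter (R : realType) (r : nat) (T : param R r) (hT : ITM T) a n :
  (0 < r)%N -> valid a -> valid (iter n (sitm T) a).
Proof. by move=> r0 va; elim: n => //= n; apply: valid_sitm. Qed.

(** For increasing breakpoints and a valid [a] only the term of the branch of [a] survives. The form
    of a sum over all branches lets it be exchanged with sums along an orbit. *)
Definition branch_val (R : realType) (r : nat) (T : param R r) (v : 'I_r -> R)
  (a : spoint R) : R := \sum_l (in_branch T l a)%:R * v l.

Lemma branch_valE (R : realType) (r : nat) (T : param R r) (hT : bet_increasing T) v l a :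
  in_branch T l a -> branch_val T v a = v l.
Proof.
move=> hl; rewrite /branch_val (bigD1 l) //= hl mul1r big1 ?addr0 // => m ml.
case hm: (in_branch T m a); last by rewrite mul0r.
by rewrite (in_branch_uniq hT hm hl) eqxx in ml.
Qed.

Definition cong (R : realType) (N : nat) (x y : R) :=
  exists k : int, x = y + k%:~R / N%:R.

Lemma cong_refl (R : realType) N (x : R) : cong N x x.
Proof. by exists 0; rewrite mul0r addr0. Qed.

Lemma cong_sym (R : realType) N (x y : R) : cong N x y -> cong N y x.
Proof. by case=> k ->; exists (- k); rewrite mulrNz mulNr addrK. Qed.

Lemma cong_trans (R : realType) N (x y z : R) : cong N x y -> cong N y z -> cong N x z.
Proof. by case=> k -> [l ->]; exists (l + k); rewrite mulrzDr mulrDl addrA. Qed.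

Definition ratgam (R : realType) (r : nat) (T : param R r) (N : nat) :=
  (0 < N)%N /\ forall l, cong N (gam T l) 0.

Lemma cong_sitm (R : realType) (r : nat) (T : param R r) N a :
  ratgam T N -> cong N (sitm T a).1 a.1.
Proof.
case=> N0 hg; have H l x : cong N (x + gam T l) x.
  by have [k ->] := hg l; exists k; rewrite add0r.
case: a => x [] /=; rewrite /sitm /= /itm; case: pickP => [l _|_] //=;
  exact: cong_refl.
Qed.

Lemma cong_iter (R : realType) (r : nat) (T : param R r) N a n :
  ratgam T N -> cong N (iter n (sitm T) a).1 a.1.
Proof.
move=> h; elim: n => [|n IH] /=; first exact: cong_refl.
exact: cong_trans (cong_sitm _ h) IH.
Qed.

(* A point of the class of x is determined by the cell of the grid (1/N)Z
   in which it lies. *)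
Definition cell (R : realType) (N : nat) (a : spoint R) : int :=
  if a.2 then Num.floor (N%:R * a.1) else Num.ceil (N%:R * a.1) - 1.

Lemma cell_bound (R : realType) N (a : spoint R) : (0 < N)%N -> valid a ->
  (0 <= cell N a < N%:Z)%R.
Proof.
move=> N0; have NR : 0 < N%:R :> R by rewrite ltr0n.
case: a => x []; rewrite /cell /valid /= => /andP[x0 x1].
  rewrite floor_ge0 mulr_ge0 ?(ltW NR) //=.
  by rewrite floor_lt_int -[ltRHS](mulr1 N%:R) ltr_pM2l.
have : 0 < Num.ceil (N%:R * x) by rewrite ceil_gt_int mulr_gt0.
have : Num.ceil (N%:R * x) <= N%:Z.
  by rewrite ceil_le_int -[leRHS](mulr1 N%:R) ler_pM2l.
by lia.
Qed.

(** A shift by k/N moves the cell number by exactly k, so equal cells force k = 0. *)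
Lemma cell_inj (R : realType) N (a b : spoint R) : (0 < N)%N -> a.2 = b.2 ->
  cong N a.1 b.1 -> cell N a = cell N b -> a = b.
Proof.
move=> N0; have NR : 0 < N%:R :> R by rewrite ltr0n.
case: a b => [x s] [y s'] /= <- [k ->]; rewrite /cell /=.
have e : N%:R * (y + k%:~R / N%:R) = N%:R * y + k%:~R.
  by rewrite mulrDr mulrCA mulfV ?mulr1 // gt_eqF.
case: s => /=; rewrite e; set c := N%:R * y.
  rewrite floorDrz ?intr_int // intrKfloor -[RHS]addr0 => /addrI ->.
  by rewrite mul0r addr0.
rewrite ceilDrz ?intr_int // intrKceil => /addIr; rewrite -[RHS]addr0 => /addrI ->.
by rewrite mul0r addr0.
Qed.

(** * Periodicity and one-sided germs *)

Lemma iter_mul_fix (A : Type) (f : A -> A) (p k : nat) (a : A) :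
  iter p f a = a -> iter (k * p) f a = a.
Proof. by move=> h; elim: k => // k IH; rewrite mulSn iterD IH. Qed.

Section Rational.
Context (R : realType) (r : nat) (T : param R r) (N : nat).
Context (r0 : (0 < r)%N) (hT : ITM T) (hN : ratgam T N).
Local Notation f := (sitm T).

(* A class of the grid meets [0, 1) in N points, so N! is a common period of all
   periodic points. *)
Definition per (a : spoint R) := valid a /\ iter N`! f a = a.

(** Pigeonhole: the points at times 0 to N share their sign and their class, and only N cells are
    available. *)
Lemma orbit_collision a : valid a ->
  exists i j, (i < j <= N)%N /\ iter i f a = iter j f a.
Proof.
move=> va; have [N0 _] := hN.
pose g (k : 'I_N.+1) : 'I_N := insubd (Ordinal N0) `|cell N (iter k f a)|%N.
have gE k : (g k : nat) = `|cell N (iter k f a)|%N.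
  rewrite val_insubd; case: ifP => // /negP[].
  by have := cell_bound N0 (valid_iter hT k r0 va); lia.
have : ~~ injectiveb g.
  by apply/negP => /injectiveP /leq_card; rewrite !card_ord ltnn.
move=> /injectivePn[x [y]].
wlog: x y / (x < y)%N.
  move=> W; case: (ltngtP x y) => [h|h|/val_inj ->]; last by rewrite eqxx.
    exact: W.
  by rewrite eq_sym => ne e; apply: (W y x).
move=> xy _ e; exists x, y; split; first by rewrite xy -ltnS ltn_ord.
apply: (cell_inj N0); first by rewrite !iter_sign.
  by apply: cong_trans (cong_iter _ _ hN) (cong_sym (cong_iter _ _ hN)).
have := congr1 (@nat_of_ord _) e; rewrite !gE.
have := cell_bound N0 (valid_iter hT x r0 va).
have := cell_bound N0 (valid_iter hT y r0 va).
by lia.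
Qed.

Lemma per_valid a : per a -> valid a. Proof. by case. Qed.

(** By time N the orbit has entered a cycle of length at most N, and such a length divides N!. *)
Lemma per_iter_large a n : valid a -> (N <= n)%N -> per (iter n f a).
Proof.
move=> va Nn; split; first exact: valid_iter.
have [i [j [/andP[ij jN] e]]] := orbit_collision va.
have -> : n = ((n - i) + i)%N by lia.
rewrite iterD; set b := iter i f a.
have e1 : iter (j - i) f b = b by rewrite -iterD subnK // ltnW.
have /dvdnP[k ->] : (j - i %| N`!)%N by apply: dvdn_fact; lia.
by rewrite -iterD addnC iterD iter_mul_fix.
Qed.

Lemma per_sitm a : per a -> per (f a).
Proof. by case=> va e; split; [exact: valid_sitm|rewrite -iterSr iterS e]. Qed.

Lemma per_iter a n : per a -> per (iter n f a).
Proof. by move=> h; elim: n => //= n; apply: per_sitm. Qed.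

Lemma per_mul a k : per a -> iter (k * N`!) f a = a.
Proof. by case=> _; apply: iter_mul_fix. Qed.

Lemma iter_inj a b n : per a -> per b -> iter n f a = iter n f b -> a = b.
Proof.
move=> pa pb e; rewrite -(per_mul n pa) -(per_mul n pb).
have -> : (n * N`! = n * (N`!).-1 + n)%N by clear r0; have := fact_gt0 N; nia.
by rewrite !iterD e.
Qed.

Lemma periodic_per a n : valid a -> (0 < n)%N -> iter n f a = a -> per a.
Proof.
move=> va n0 e; rewrite -(iter_mul_fix N e); apply: per_iter_large => //.
by nia.
Qed.

Lemma per_reach a b n : per b -> iter n f b = a -> exists k, iter k f a = b.
Proof.
move=> pb <-; exists (n * (N`!).-1)%N.
rewrite -iterD -[RHS](per_mul n pb); congr iter.
by clear r0; have := fact_gt0 N; nia.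
Qed.

(** Points of the N-th image are already periodic; conversely, a periodic point has preimages of
    every order in its own cycle. *)
Lemma Xlim_per t : Xlim T t <-> per (t, true).
Proof.
split=> [h|h].
  have [x /= hx <-] := h N I.
  rewrite (_ : (_, true) = iter N f (x, true)); last by rewrite iter_sitm_true.
  exact: per_iter_large.
move=> n _; exists (iter (n * (N`!).-1) f (t, true)).1.
  have := per_valid (per_iter (n * (N`!).-1) h).
  by rewrite /valid iter_sign.
have := per_mul n h; rewrite !iter_sitm_true -iterD => -[] /=.
congr (_ = _); congr iter.
by clear r0; have := fact_gt0 N; nia.
Qed.

Lemma finite_type_rational : finite_type T.
Proof.
exists N; apply/seteqP; split=> t [x hx <-].
  exists (itm T x); last by rewrite -iterSr.
  by have := @valid_sitm _ _ _ hT (x, true) r0 hx.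
have : Xlim T (iter N (itm T) x).
  rewrite Xlim_per (_ : (_, true) = iter N f (x, true)); last by rewrite iter_sitm_true.
  by apply: per_iter_large.
exact.
Qed.

End Rational.

(** The ordinary points that represent the germ [a] at scale [e]. A left germ omits its base point,
    where [itm] follows the right-hand branch. *)
Definition near_side (R : realType) (a : spoint R) (e t : R) :=
  if a.2 then a.1 <= t < a.1 + e else a.1 - e < t < a.1.

Section Germs.
Context (R : realType) (r : nat) (T : param R r).
Context (r0 : (0 < r)%N) (hT : ITM T).
Local Notation f := (sitm T).

Lemma near_side_le a e e' t : e <= e' -> near_side a e t -> @near_side R a e' t.
Proof.
rewrite /near_side => ee; case: a.2 => /andP[h1 h2]; apply/andP; split; lra.
Qed.

Lemma germ1 a : valid a -> exists2 e, 0 < e &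
  forall t, near_side a e t -> valid (t, true) /\ f (t, true) = ((f a).1 + (t - a.1), true).
Proof.
move=> va; have [l hl] := in_branch_exists hT.1 r0 va.
suff [e e0 he] : exists2 e, 0 < e & forall t, near_side a e t -> in_branch T l (t, true).
  exists e => // t ht; rewrite (sitmE hT.1 hl) (sitmE hT.1 (he _ ht)) /=; split.
    exact: (valid_in_branch hT.1 (he _ ht)).
  by congr (_, true); lra.
move: hl; rewrite /in_branch /near_side; case: a.2 => /andP[h1 h2].
  exists (bet T l.+1 - a.1); first by lra.
  by move=> t /= /andP[? ?]; apply/andP; split; lra.
exists (a.1 - bet T l); first by lra.
by move=> t /= /andP[? ?]; apply/andP; split; lra.
Qed.

(** Close to [a] on its own side, the first [n] steps use the branches that [a] uses, so they act as
    one translation. This turns statements about left germs, too, into statements about ordinary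
    points. *)
Lemma germ a n : valid a -> exists2 e, 0 < e &
  forall t, near_side a e t -> valid (t, true) /\
   iter n f (t, true) = ((iter n f a).1 + (t - a.1), true).
Proof.
move=> va; elim: n => [|n [e e0 he]].
  have [e e0 he] := germ1 va; exists e => // t /he[vt _]; split => //=.
  by congr (_, true); lra.
have [e' e'0 he'] := germ1 (valid_iter hT n r0 va).
exists (Num.min e e') => [|t ht]; first by rewrite lt_min e0.
have [m1 m2] : Num.min e e' <= e /\ Num.min e e' <= e'.
  by rewrite !ge_min !lexx orbT.
have [vt IH] := he _ (near_side_le m1 ht); split => //.
rewrite !iterS IH; have [|_ ->] := he' ((iter n f a).1 + (t - a.1)).
  move: (near_side_le m2 ht); rewrite /near_side iter_sign.
  by case: a.2 => /andP[? ?]; apply/andP; split; lra.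
by congr (_, true); lra.
Qed.

End Germs.

(** * Components of the attractor *)

Section Components.
Context (R : realType) (r : nat) (T : param R r) (N : nat).
Context (r0 : (0 < r)%N) (hT : ITM T) (hN : ratgam T N).
Local Notation f := (sitm T).
Local Notation per := (per T N).
Local Notation C := (connected_component (Xlim T)).

(** By [germ] the N!-th iterate translates the whole germ by one amount, and both sides say that
    this amount is 0. *)
Lemma Xlim_near a : valid a -> exists2 e, 0 < e &
  forall t, near_side a e t -> Xlim T t <-> per a.
Proof.
move=> va; have [e e0 he] := germ r0 hT N`! va; exists e => // t /he[vt ht].
rewrite (Xlim_per r0 hT hN); split=> -[_ h]; split => //.
  rewrite [LHS]surjective_pairing iter_sign [RHS]surjective_pairing; congr (_, _).
  by move: h; rewrite ht => -[]; lra.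
by rewrite ht h; congr (_, _); lra.
Qed.

Lemma Xlim01 t : Xlim T t -> 0 <= t < 1.
Proof. by move=> /(Xlim_per r0 hT hN)[]. Qed.

Lemma component_itv z a b : C z a -> C z b -> forall t, a <= t <= b -> C z t.
Proof.
have /connected_intervalP H := @component_connected _ (Xlim T) z.
by move=> Ca Cb t ht; apply: (H a b).
Qed.

Lemma component_extend z a b t : C z a -> a <= t <= b \/ b <= t <= a ->
  (forall u, a <= u <= b \/ b <= u <= a -> Xlim T u) -> C z t.
Proof.
move=> Ca ht hX; apply: (connected_component_trans Ca).
have H p q : p <= a <= q -> p <= t <= q -> (forall u, p <= u <= q -> Xlim T u) -> C a t.
  move=> ha ht' hX'.
  have cI : connected [set` `[p, q]].
    by apply/connected_intervalP; apply: interval_is_interval.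
  have sI : [set` `[p, q]] `<=` Xlim T.
    by move=> u; rewrite /= in_itv /=; apply: hX'.
  have aI : [set` `[p, q]] a by rewrite /= in_itv.
  by apply: (connected_component_max aI sI cI); rewrite /= in_itv.
case: ht => /andP[h1 h2].
  apply: (H a b); rewrite ?lexx ?h1 ?h2 ?(le_trans h1 h2) //.
  by move=> u hu; apply: hX; left.
apply: (H b a); rewrite ?lexx ?h1 ?h2 ?(le_trans h1 h2) //.
by move=> u hu; apply: hX; right.
Qed.

(** The infimum belongs to the component: its right germ contains points of X, so the whole germ
    lies in X. The supremum does not, since its right germ would then lie in X and extend the
    component. *)
Lemma component_halfopen z : Xlim T z ->
  exists x y, C z = [set t | x <= t < y].
Proof.
move=> Xz; have Cz : C z z by apply: connected_component_refl.
have CX : C z `<=` Xlim T by apply: connected_component_sub.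
have lbC : has_lbound (C z) by exists 0 => t /CX/Xlim01/andP[].
have ubC : has_ubound (C z) by exists 1 => t /CX/Xlim01/andP[_ /ltW].
have iC : has_inf (C z) by split => //; exists z.
have sC : has_sup (C z) by split => //; exists z.
set x := inf (C z); set y := sup (C z).
have xle t : C z t -> x <= t by move=> ?; apply: ge_inf.
have ley t : C z t -> t <= y by move=> ?; apply: ub_le_sup.
have Cx : C z x.
  have vx : valid (x, true).
    rewrite /valid /=; apply/andP; split.
      by apply: lb_le_inf; [exists z | move=> t /CX/Xlim01/andP[]].
    by apply: le_lt_trans (xle _ Cz) _; have /andP[] := Xlim01 Xz.
  have [e e0 he] := Xlim_near vx.
  have [t Ct tx] : exists2 t, C z t & t < x + e.
    by apply: inf_adherent.
  have px : per (x, true).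
    by rewrite -(he t) ?/near_side /= ?xle //; exact: CX.
  apply: (component_extend Ct (b := x)); first by right; rewrite lexx xle.
  move=> u [|] /andP[h1 h2].
    by rewrite (_ : u = t); [exact: CX | have := xle _ Ct; lra].
  by apply/(he u) => //; rewrite /near_side /= h1 (le_lt_trans h2 tx).
have Cy : ~ C z y.
  move=> Cy; have [e e0 he] := Xlim_near (a := (y, true)) (Xlim01 (CX _ Cy)).
  have py : per (y, true) by rewrite -(Xlim_per r0 hT hN); exact: CX.
  suff /ley : C z (y + e / 2) by lra.
  apply: (component_extend Cy (b := y + e / 2)); first by left; lra.
  move=> u hu; apply/(he u) => //; rewrite /near_side /=.
  by case: hu => /andP[? ?]; apply/andP; split; lra.
exists x, y; apply/seteqP; split=> t /=.
  move=> Ct; rewrite xle //= lt_neqAle ley // andbT.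
  by apply/eqP => ty; apply: Cy; rewrite -ty.
case/andP=> xt ty.
have [u Cu tu] : exists2 u, C z u & t < u.
  have [|u Cu] := @sup_adherent _ (C z) (y - t) _ sC; first by lra.
  by rewrite subKr => tu; exists u.
by apply: (component_itv Cx Cu); rewrite xt ltW.
Qed.

Lemma component_memX x y t : component T x y -> x <= t < y -> Xlim T t.
Proof.
case=> z Xz e ht; apply: (@connected_component_sub _ (Xlim T) z).
by rewrite e.
Qed.

Lemma component_lt x y : component T x y -> x < y.
Proof.
case=> z Xz e; have : C z z by apply: connected_component_refl.
by rewrite e /= => /andP[]; apply: le_lt_trans.
Qed.

Lemma component_bound x y : component T x y -> 0 <= x /\ y <= 1.
Proof.
move=> c; have xy := component_lt c; split.
  have /Xlim01/andP[] // : Xlim T x by apply: (component_memX c); rewrite lexx xy.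
rewrite leNgt; apply/negP => y1; pose t := Num.max x 1.
have : Xlim T t.
  by apply: (component_memX c); rewrite /t le_max lexx gt_max xy y1.
by move=> /Xlim01/andP[_]; rewrite /t gt_max ltxx andbF.
Qed.

Lemma spoints_valid x y a : component T x y -> spoints x y a -> valid a.
Proof.
move=> /component_bound[x0 y1]; rewrite /spoints /valid /=.
by case: a.2 => /andP[? ?]; apply/andP; split; lra.
Qed.

Lemma spoints_per x y a : component T x y -> spoints x y a -> per a.
Proof.
move=> c ha; have va := spoints_valid c ha; have [e e0 he] := Xlim_near va.
(* For a left germ, [t] must be within [e] of the base point and still to the right of [x]; the
   maximum meets both demands. *)
pose t := if a.2 then a.1 else Num.max (a.1 - e / 2) ((x + a.1) / 2).
have [ht xt] : near_side a e t /\ x <= t < y.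
  move: ha; rewrite /spoints /near_side /t /=; case: a.2 => /andP[h1 h2].
    by rewrite h1 h2; split => //; apply/andP; split; lra.
  rewrite !lt_max !gt_max !le_max; split; apply/andP; split.
  - by apply/orP; left; lra.
  - by apply/andP; split; lra.
  - by apply/orP; right; lra.
  - by apply/andP; split; lra.
by apply/(he t ht); apply: (component_memX c xt).
Qed.

(** If both germs at [w] are periodic, X contains a neighbourhood of [w], so [w] is no endpoint of a
    component. *)
Lemma component_interior x y w s : component T x y -> per (w, false) ->
  per (w, true) -> spoints x y (w, s) -> x < w < y.
Proof.
move=> c pm pp hs; have xy := component_lt c; have [z Xz Cz] := c.
have [wx|wx] := eqVneq w x.
  exfalso; rewrite wx in pm; have [e e0 he] := Xlim_near (per_valid pm).
  have Cx : C z x by rewrite Cz /= lexx.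
  have : C z (x - e / 2).
    apply: (component_extend Cx (b := x - e / 2)); first by right; lra.
    move=> u hu; have [->|ux] := eqVneq u x; first by apply: (component_memX c); rewrite lexx.
    apply/(he u) => //; rewrite /near_side /=.
    move: ux; rewrite neq_lt => /orP ux.
    by case: hu => /andP[? ?]; apply/andP; split; case: ux => ux; lra.
  by rewrite Cz /=; lra.
have [wy|wy] := eqVneq w y; last first.
  by move: hs; rewrite /spoints /= !lt_neqAle (eq_sym x); case: s; rewrite wx wy /=.
exfalso; rewrite {w wx hs}wy in pm pp.
have : C z y; last by rewrite Cz /= ltxx andbF.
have Cx : C z x by rewrite Cz /= lexx.
apply: (component_extend Cx (b := y)); first by left; rewrite lexx ltW.
move=> u hu; have [->|uy] := eqVneq u y; first exact/(Xlim_per r0 hT hN).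
apply: (component_memX c); move: uy; rewrite neq_lt => /orP uy.
by case: hu => /andP[? ?]; apply/andP; split; case: uy => uy; lra.
Qed.

Lemma per_sXlim a : per a -> sXlim T a.
Proof.
move=> pa; have [e e0 he] := Xlim_near (per_valid pa).
case: a => w [] /= in pa he *; rewrite /near_side /= in he.
  have Xw : Xlim T w by apply/(Xlim_per r0 hT hN).
  have [x [y Cxy]] := component_halfopen Xw.
  exists x, y; split; first by exists w.
  have : C w w by apply: connected_component_refl.
  by rewrite Cxy.
have [t wt tw] : exists2 t, w - e < t & t < w by exists (w - e / 2); lra.
have Xt : Xlim T t by apply/(he t) => //; rewrite wt tw.
have Ctt : C t t by apply: connected_component_refl.
have [x [y Cxy]] := component_halfopen Xt.
exists x, y; split; first by exists t.
move: (Ctt); rewrite Cxy /spoints /= => /andP[xt ty].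
(* If the component of [t] ended at [y < w], then [y] would lie in the left germ of [w], hence in X,
   and the component would extend. *)
rewrite (le_lt_trans xt tw) /= leNgt; apply/negP => yw.
have : C t y; last by rewrite Cxy /= ltxx andbF.
apply: (component_extend Ctt (b := y)); first by left; rewrite lexx ltW.
move=> u hu; apply/(he u) => //.
by apply/andP; split; case: hu => /andP[? ?]; lra.
Qed.

End Components.

(** * The balance of the two orbits of a discontinuity *)

(** Modulo (1/N)Z this puts each interior breakpoint in a class of its own. The cases [m = 0] and
    [m = r] separate it also from the class of 0 and 1. *)
Definition generic (R : realType) (r : nat) (T : param R r) :=
  forall j m, (0 < j < r)%N -> (m <= r)%N -> m <> j ->
    irrational (bet T j - bet T m).

Definition flip (R : realType) (a : spoint R) : spoint R := (a.1, ~~ a.2).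

Lemma Posz_sum (I : finType) (F : I -> nat) :
  (\sum_i F i)%N%:Z = \sum_i (F i)%:Z.
Proof. exact: (big_morph Posz PoszD). Qed.

Lemma neqb_neg (s t : bool) : s != t -> t = ~~ s.
Proof. by case: s; case: t. Qed.

Lemma sum_cycle (F : nat -> nat) (M : nat) : F M = F 0%N ->
  (\sum_(k < M) F k.+1 = \sum_(k < M) F k)%N.
Proof.
case: M => [|M] e; first by rewrite !big_ord0.
by rewrite big_ord_recr big_ord_recl /= e addnC.
Qed.

(** * One breakpoint per class: conditions A1 and A3 *)

Section Classes.
Context (R : realType) (r : nat) (T : param R r) (N : nat).
Context (r0 : (0 < r)%N) (hT : ITM T) (hN : ratgam T N) (hg : generic T).
Local Notation f := (sitm T).
Local Notation per := (per T N).

Lemma class_uniq i m : (0 < i < r)%N -> (m <= r)%N ->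
  cong N (bet T i) (bet T m) -> m = i.
Proof.
move=> hi hm [k e]; apply: contrapT => mi; apply: (hg hi hm mi).
by apply/rationalP; exists k, N; rewrite e addrC addKr.
Qed.

Lemma crit_class i m a b : (0 < i < r)%N -> (m <= r)%N -> cong N a b ->
  a = bet T i -> b = bet T m -> m = i.
Proof. by move=> hi hm h ea eb; apply: class_uniq => //; rewrite -ea -eb. Qed.

Lemma in_branch_flip l a : (forall m, (m <= r)%N -> a.1 <> bet T m) ->
  in_branch T l (flip a) = in_branch T l a.
Proof.
move=> hm; have /eqP := hm l (ltnW (ltn_ord l)); have /eqP := hm l.+1 (ltn_ord l).
rewrite !neq_lt => /orP h1 /orP h2; rewrite /in_branch /flip /=.
by case: a.2 => /=; apply/idP/idP => /andP[h3 h4]; apply/andP; split;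
  case: h1 h2 => h1 [] h2; lra.
Qed.

Lemma sitm_flip a : valid a -> (forall m, (m <= r)%N -> a.1 <> bet T m) ->
  f (flip a) = flip (f a).
Proof.
move=> va hm; have [l hl] := in_branch_exists hT.1 r0 va.
have hl' : in_branch T l (flip a) by rewrite in_branch_flip.
by rewrite (sitmE hT.1 hl) (sitmE hT.1 hl').
Qed.

(** The two germs at a point separate only at a breakpoint, and the only breakpoint in this class is
    the i-th one. So they travel together up to the first visit [j'] there. *)
Lemma together i a j : (0 < i < r)%N -> valid a -> (iter j f a).1 = bet T i ->
  exists2 j', (j' <= j)%N & (iter j' f a).1 = bet T i /\
    forall k, (k <= j')%N -> iter k f (flip a) = flip (iter k f a).
Proof.
move=> hi va ej.
have ex : exists j', (iter j' f a).1 == bet T i by exists j; apply/eqP.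
have [j' /eqP e' jmin] := ex_minnP ex.
exists j'; first by apply: jmin; apply/eqP.
split=> // k; elim: k => // k IH kj; rewrite iterS IH ?(ltnW kj) //.
apply: sitm_flip => [|m hm e]; first exact: valid_iter.
have mi : m = i.
  apply: (crit_class hi hm _ e' e); have -> : j' = ((j' - k) + k)%N by lia.
  by rewrite iterD; apply: cong_iter.
have : (j' <= k)%N by apply: jmin; rewrite e mi.
by lia.
Qed.

Lemma reach_flip i a j : (0 < i < r)%N -> valid a ->
  iter j f a = (bet T i, a.2) -> exists j', iter j' f (flip a) = (bet T i, ~~ a.2).
Proof.
move=> hi va e; have [|j' _ [e' h]] := together (j := j) hi va; first by rewrite e.
by exists j'; rewrite h // /flip e' iter_sign.
Qed.

(** All points of an orbit lie in one class, which contains at most one interior breakpoint, and the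
    sign never changes. *)
Lemma A1_generic : A1 T.
Proof.
move=> x y a _ _ c d [j _ <-] [i /andP[i0 ir] ei] [k _ <-] [m /andP[m0 mr] em].
rewrite [LHS]surjective_pairing [RHS]surjective_pairing !iter_sign ei em.
congr (bet T _, _); apply/esym/(crit_class _ _ _ ei em); rewrite ?i0 ?ir ?(ltnW mr) //.
exact: cong_trans (cong_iter _ _ hN) (cong_sym (cong_iter _ _ hN)).
Qed.

Lemma crit_valid i s : (0 < i < r)%N -> valid (bet T i, s).
Proof.
case/andP=> i0 ir; have := @bet_lt _ _ _ hT.1 0 i; rewrite i0 (ltnW ir) bet_first.
have := @bet_lt _ _ _ hT.1 i r; rewrite ir leqnn bet_last //.
by move=> /(_ isT) h1 /(_ isT) h2; rewrite /valid /=; case: s; rewrite ?h1 ?h2 ?ltW.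
Qed.

(** A ghost preimage lies in the class of [b], so it sits at the same breakpoint with the opposite
    sign; the germ it is required to reach is then itself. *)
Lemma ghost_flip a b : ghost_preimage T a b -> a = flip b /\ exists2 k, (0 < k)%N & iter k f a = a.
Proof.
case=> [[i /andP[i0 ir] ei] [m /andP[m0 mr] em] es [k k0 ek]].
have mi : i = m.
  apply: (@crit_class m i b.1 a.1); rewrite ?m0 ?(ltnW ir) //.
  by have := cong_iter a k hN; rewrite ek.
have ea : a = flip b by rewrite /flip em -es -mi -ei -surjective_pairing.
by split => //; exists k; rewrite // ek ea.
Qed.

(** Occurring at a positive level makes [b] a ghost preimage, hence periodic, hence a point of X. *)
Lemma A3_generic : A3 T.
Proof.
move=> b [i ir ei] hb n; rewrite /= => -[c _ /ghost_flip[_ [k k0 e]]].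
apply/hb/(per_sXlim r0 hT hN)/(periodic_per r0 hT hN _ k0 e).
by rewrite (surjective_pairing b) ei; apply: crit_valid.
Qed.

End Classes.

(** * The invariant balance function of one discontinuity *)

Section Balance.
Context (R : realType) (r : nat) (T : param R r) (N : nat).
Context (r0 : (0 < r)%N) (hT : ITM T) (hN : ratgam T N) (hg : generic T).
Local Notation f := (sitm T).
Local Notation per := (per T N).
Local Notation M := N`!.
Context (i : nat) (hi : (0 < i < r)%N).

Definition orb (s : bool) (k : nat) : spoint R := iter k f (bet T i, s).

Definition visits (s : bool) (l : 'I_r) : nat := (\sum_(k < M) in_branch T l (orb s k))%N.

(* y is to the right of the one-sided germ a. *)
Definition right_of (y : R) (a : spoint R) : bool :=
  if a.2 then a.1 < y else a.1 <= y.

Definition right_count (s : bool) (a : spoint R) : nat :=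
  (\sum_(k < M) right_of (orb s k).1 a)%N.

Definition right_countl (s : bool) (l : 'I_r) (a : spoint R) : nat :=
  (\sum_(k < M) (in_branch T l (orb s k) && right_of (orb s k).1 a))%N.

Definition balance (a : spoint R) : int := (right_count false a)%:Z - (right_count true a)%:Z.

Definition balancel (l : 'I_r) (a : spoint R) : int :=
  (right_countl false l a)%:Z - (right_countl true l a)%:Z.

(** Every visit during N! steps counts, so a cycle shorter than N! passes each of its points several
    times. *)
Definition mult (s : bool) (x : R) : nat := (\sum_(k < M) ((orb s k).1 == x))%N.

Lemma orb_valid s k : valid (orb s k).
Proof. by apply: valid_iter => //; apply: crit_valid. Qed.

Lemma orb_sign s k : (orb s k).2 = s.
Proof. exact: iter_sign. Qed.

Lemma orb_cong s k : cong N (orb s k).1 (bet T i).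
Proof. exact: (cong_iter (bet T i, s) k hN). Qed.

Lemma sum_in_branch (a : spoint R) : valid a -> (\sum_l in_branch T l a = 1)%N.
Proof.
move=> va; have [l hl] := in_branch_exists hT.1 r0 va.
rewrite (bigD1 l) //= hl big1 // => m ml; case hm: (in_branch T m a) => //.
by rewrite (in_branch_uniq hT.1 hm hl) eqxx in ml.
Qed.

Lemma right_count_sum s a : right_count s a = (\sum_l right_countl s l a)%N.
Proof.
rewrite exchange_big; apply: eq_bigr => k _ /=.
under eq_bigr => l _ do rewrite -mulnb.
by rewrite -big_distrl /= sum_in_branch ?mul1n //; apply: orb_valid.
Qed.

Lemma right_countl_out s l a : ~~ in_branch T l a -> right_countl s l a =
  if (if a.2 then a.1 < bet T l else a.1 <= bet T l) then visits s l else 0%N.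
Proof.
move=> nl; case: ifPn => hl.
  apply: eq_bigr => k _; congr nat_of_bool; case h: in_branch => //=.
  move: h hl; rewrite /in_branch /right_of orb_sign.
  by case: s => /andP[? ?]; case: a.2 => ?; lra.
apply: big1 => k _; case h: in_branch => //=; apply/eqP; rewrite eqb0.
move: h hl nl; rewrite /in_branch /right_of orb_sign.
case: s => /andP[? ?]; case: a.2; rewrite -?ltNge -?leNgt => h1;
  rewrite h1 /= -?ltNge -?leNgt => h2; lra.
Qed.

(** Only orbit points equal to [x] matter: they count as right of the left germ but not of the right
    germ. *)
Lemma mult_jump s x :
  right_count s (x, false) = (right_count s (x, true) + mult s x)%N.
Proof.
rewrite /right_count /mult -big_split /=; apply: eq_bigr => k _; rewrite /right_of /=.
by case: (ltgtP x (orb s k).1).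
Qed.

Hypothesis hp : forall s, per (bet T i, s).
Hypothesis hv : visits false = visits true.

Lemma orb_per s k : per (orb s k). Proof. exact: per_iter. Qed.

Lemma orb_cycle s : orb s M = orb s 0. Proof. by case: (hp s). Qed.

(** The branch lies entirely on one side of [a], so each orbit contributes all its visits to the
    branch or none, and by [hv] the two orbits visit it equally often. *)
Lemma balancel_out l a : ~~ in_branch T l a -> balancel l a = 0.
Proof. by move=> h; rewrite /balancel !right_countl_out // hv subrr. Qed.

Lemma balance_sum a : balance a = \sum_l balancel l a.
Proof. by rewrite /balance !right_count_sum sumrB !Posz_sum. Qed.

Lemma balance_in_branch l a : in_branch T l a -> balance a = balancel l a.
Proof.
move=> hl; rewrite balance_sum (bigD1 l) //= big1 ?addr0 // => m ml.
apply: balancel_out; apply/negP => hm.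
by rewrite (in_branch_uniq hT.1 hm hl) eqxx in ml.
Qed.

(** The orbit is a cycle, so its points may be replaced by their images; these are then sorted by
    the branch of the predecessor. *)
Lemma right_count_push s a : right_count s a = (\sum_l right_countl s l ((a.1 - gam T l)%R, a.2))%N.
Proof.
rewrite exchange_big /= /right_count.
rewrite -(sum_cycle (F := fun k => right_of (orb s k).1 a)); last first.
  by rewrite orb_cycle.
apply: eq_bigr => k _ /=; have [l hl] := in_branch_exists hT.1 r0 (orb_valid s k).
rewrite (bigD1 l) //= hl big1 ?addn0 => [|m ml].
  rewrite (sitmE hT.1 hl) /right_of /=.
  by case: a.2; rewrite ?ltrBlDr ?lerBlDr.
case hm: in_branch => //; by rewrite (in_branch_uniq hT.1 hm hl) eqxx in ml.
Qed.

(** The balance is fixed by the transfer operator: it sums over the preimages of [a], and a branch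
    without a preimage contributes 0 by [balancel_out]. *)
Lemma balance_push a : balance a =
  \sum_l (let b := (a.1 - gam T l, a.2) in if in_branch T l b then balance b else 0).
Proof.
rewrite {1}/balance !right_count_push !Posz_sum -sumrB; apply: eq_bigr => l _ /=.
by case: ifPn => hl; [rewrite (balance_in_branch hl)|rewrite -[LHS]/(balancel _ _) balancel_out].
Qed.

Lemma balance_back a n : balance a != 0 ->
  exists b, [/\ valid b, iter n.+1 f b = a & balance b != 0].
Proof.
have step c : balance c != 0 -> exists b, [/\ valid b, f b = c & balance b != 0].
  move=> hc; have [l hl] : exists l, let b := (c.1 - gam T l, c.2) in
      in_branch T l b /\ balance b != 0.
    apply: contrapT => H; move/negP: hc; apply; rewrite balance_push big1 //.
    move=> l _ /=; case: ifPn => // hl; apply: contrapT => /eqP h.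
    by apply: H; exists l.
  exists (c.1 - gam T l, c.2); case: hl => h1 h2; split => //.
    exact: (valid_in_branch hT.1 h1).
  by rewrite (sitmE hT.1 h1) /= subrK -surjective_pairing.
elim: n => [|n IH] ha; first by have [b hb] := step _ ha; exists b.
have [b [vb <- hb]] := IH ha; have [c [vc <- hc]] := step _ hb.
by exists c; split => //; rewrite iterSr.
Qed.

(* The balance is preserved by push-forward, so it lives on the eventual image. *)
Lemma balance_per a : balance a != 0 -> per a.
Proof.
move=> /(balance_back N)[b [vb <- _]]; apply: per_iter_large => //.
Qed.

(** Only periodic preimages of [f a] have nonzero balance, and [f] is injective on periodic points,
    so [a] alone contributes. *)
Lemma balance_sitm a : per a -> balance (f a) = balance a.
Proof.
move=> pa; have [l hl] := in_branch_exists hT.1 r0 (per_valid pa).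
have e := sitmE hT.1 hl.
have el : ((f a).1 - gam T l, (f a).2) = a by rewrite e /= addrK -surjective_pairing.
rewrite balance_push (bigD1 l) //= el hl big1 ?addr0 // => m ml.
set b := (_, _); case: ifPn => // hm; apply: contrapT => /eqP/balance_per pb.
have fb : f b = f a.
  by rewrite (sitmE hT.1 hm) /b /= subrK e.
have ba : b = a := @iter_inj _ _ _ _ _ _ 1 pb pa fb.
by move: ml; rewrite (in_branch_uniq hT.1 (m := l) hm) ?eqxx // ba.
Qed.

Lemma balance_iter a k : per a -> balance (iter k f a) = balance a.
Proof.
move=> pa; elim: k => //= k <-; apply: balance_sitm; exact: per_iter.
Qed.

Lemma balance_jump x : balance (x, false) =
  balance (x, true) + (mult false x)%:Z - (mult true x)%:Z.
Proof. by rewrite /balance !mult_jump; lia. Qed.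

Lemma mult_sitm s b : per b -> b.2 = s -> mult s (f b).1 = mult s b.1.
Proof.
move=> pb bs; rewrite /mult -(sum_cycle (F := fun k => ((orb s k).1 == (f b).1) : nat)); last first.
  by rewrite orb_cycle.
apply: eq_bigr => k _; congr nat_of_bool; apply/eqP/eqP => e.
  suff -> : b = orb s k by [].
  apply: (@iter_inj _ _ _ _ _ _ 1 pb (orb_per s k)).
  by rewrite /= [LHS]surjective_pairing -e [RHS]surjective_pairing !sitm_sign bs orb_sign.
have -> : b = orb s k by rewrite [LHS]surjective_pairing -e [RHS]surjective_pairing bs orb_sign.
by [].
Qed.

Lemma mult_orb s k : mult s (orb s k).1 = mult s (bet T i).
Proof.
by elim: k => //= k <-; apply: mult_sitm; [exact: orb_per|exact: orb_sign].
Qed.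

Lemma orb_mod s k : orb s k = orb s (k %% M).
Proof.
rewrite /orb {1}(divn_eq k M) addnC iterD; congr iter.
exact: per_mul.
Qed.

Lemma mult_gt0 s k x : (orb s k).1 = x -> (0 < mult s x)%N.
Proof.
have kM : (k %% M < M)%N by rewrite ltn_mod fact_gt0.
rewrite orb_mod => e; rewrite /mult (bigD1 (Ordinal kM)) //=.
by rewrite e eqxx.
Qed.

Lemma mult_eq0 s x : ~ (exists k, (orb s k).1 = x) -> mult s x = 0%N.
Proof.
move=> h; rewrite /mult big1 // => k _; apply/eqP; rewrite eqb0.
by apply/eqP => e; apply: h; exists k.
Qed.

Lemma orb_pair s k x : (orb s k).1 = x -> orb s k = (x, s).
Proof. by move=> <-; rewrite [LHS]surjective_pairing orb_sign. Qed.

(** The germ at [x] runs on to the discontinuity and the opposite germ travels with it, arriving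
    with the opposite sign; being periodic, that germ lies on the other orbit. *)
Lemma orb_flip s k x : (orb s k).1 = x -> per (x, ~~ s) ->
  exists k', (orb (~~ s) k').1 = x.
Proof.
move=> /orb_pair e pf.
have [j ej] := per_reach (hp s) e.
have vx : valid (x, s) by rewrite -e; apply: orb_valid.
have [j' ej'] := reach_flip r0 hT hN hg hi vx ej.
have [k' ek'] := per_reach pf ej'.
by exists k'; rewrite /orb ek'.
Qed.

Lemma orb_noncrit s k : (orb s k).1 <> bet T i ->
  forall m, (m <= r)%N -> (orb s k).1 <> bet T m.
Proof.
move=> h m mr e; apply: h; rewrite e; congr (bet T _).
apply: (class_uniq (N := N) hg hi mr); rewrite -e.
exact: cong_sym (orb_cong s k).
Qed.

(* Otherwise the two orbits coincide as sets, hence pointwise, and the branch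
   to the right of the discontinuity is visited more often by the right orbit. *)
Lemma orb_only : exists s k, ~ exists k', (orb (~~ s) k').1 = (orb s k).1.
Proof.
apply: contrapT => H.
have {}H s k : exists k', (orb (~~ s) k').1 = (orb s k).1.
  by apply: contrapT => h; apply: H; exists s, k.
have f1 : f (bet T i, false) = flip (f (bet T i, true)).
  have [k' ek'] := H true 1%N.
  (* Adding a full period guarantees that the point has a predecessor [b] on the left orbit. Unless
     [b] sits at the discontinuity, its flip is a second periodic preimage of the image of the right
     germ. *)
  have ek : (orb false (k' + (M).-1).+1).1 = (orb true 1).1.
    rewrite -addnS prednK ?fact_gt0 // /orb iterD.
    by have [_ ->] := hp false.
  set b := orb false (k' + (M).-1) in ek.
  have [eb|nb] := eqVneq b.1 (bet T i).
    have eb' : b = (bet T i, false) by apply: orb_pair.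
    move: ek; rewrite /orb /= -/(orb _ _) -/b eb' => ek.
    by rewrite [LHS]surjective_pairing ek /flip !sitm_sign.
  have [j ej] := H false (k' + (M).-1)%N; rewrite -/b in ej.
  have fb : f (flip b) = f (bet T i, true).
    rewrite (sitm_flip r0 hT (orb_valid _ _)); last by apply: orb_noncrit; apply/eqP.
    by rewrite /flip -[f b]/(orb false (k' + (M).-1).+1) ek orb_sign
      -[f _]/(orb true 1) [RHS]surjective_pairing orb_sign.
  have pb : per (flip b).
    have -> : flip b = orb true j by rewrite (orb_pair ej) /flip orb_sign.
    exact: orb_per.
  have := @iter_inj _ _ _ _ _ _ 1 pb (hp true) fb => -[/eqP].
  by rewrite (negbTE nb).
have ofl k : orb false k = flip (orb true k).
  elim: k => [|k IH] //; rewrite /orb !iterS -!/(orb _ _) IH.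
  have [e|ne] := eqVneq (orb true k).1 (bet T i).
    by rewrite (orb_pair e) /flip.
  by apply: sitm_flip; [|exact: hT|exact: orb_valid|apply: orb_noncrit; apply/eqP].
have ir : (i < r)%N by case/andP: hi.
pose l := Ordinal ir.
have hl : in_branch T l (bet T i, true) by rewrite /in_branch /= lexx (hT.1 l).
have : visits true l = (visits false l + mult true (bet T i))%N.
  rewrite /visits /mult -big_split /=; apply: eq_bigr => k _; rewrite ofl.
  have [e|ne] := eqVneq (orb true k).1 (bet T i); last first.
    by rewrite addn0 in_branch_flip //; apply: orb_noncrit; apply/eqP.
  by rewrite (orb_pair e) hl /flip /in_branch /= ltxx.
by have := @mult_gt0 true 0 _ erefl; rewrite hv => h0 h1; move: h0 => /=; lia.
Qed.

(** At a point [x] of only one orbit the opposite germ is not periodic, so its balance is 0 and the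
    jump at [x] gives the other. Carried back to the discontinuity, the balance at each sign equals
    the positive multiplicity there of the orbit with that sign. *)
Lemma balance_neq0 s : balance (bet T i, s) != 0.
Proof.
have [s0 [k hk]] := orb_only; set x := (orb s0 k).1 in hk.
have hx : ~ per (x, ~~ s0) by move=> p; apply: hk; apply: orb_flip p.
have b0 : balance (x, ~~ s0) = 0 by apply/eqP; apply: contra_notT hx; apply: balance_per.
have b1 : balance (x, s0) = balance (bet T i, s0).
  by rewrite -(orb_pair (erefl x)) balance_iter.
have m0 := mult_eq0 hk; have m1 := mult_orb s0 k; rewrite -/x in m1.
have := @balance_jump x; have := @balance_jump (bet T i).
have := @mult_gt0 false 0 _ erefl; have := @mult_gt0 true 0 _ erefl.
by move: b0 b1 m0 m1; rewrite /=; case: s0 {hk hx} x => x; case: s => /=; lia.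
Qed.

Lemma balance_orb q s : (exists s' k, (orb s' k).1 = q) -> per (q, s) ->
  balance (q, s) != 0.
Proof.
move=> [s' [k e]] pq.
suff [k' /orb_pair <-] : exists k', (orb s k').1 = q by rewrite balance_iter ?balance_neq0.
have [ss|ss] := eqVneq s' s; first by rewrite -ss; exists k.
have es := neqb_neg ss.
by rewrite es in pq *; exact: (orb_flip e pq).
Qed.

Lemma orb_crit l s k : (l <= r)%N -> (orb s k).1 = bet T l -> l = i.
Proof.
move=> lr e; apply: (class_uniq (N := N) hg hi lr); rewrite -e.
exact: cong_sym (orb_cong s k).
Qed.

(** The right germ starts a branch and the left germ ends one, and neither orbit meets this
    breakpoint. So all visits to that branch, or none, lie to the right, equally many for both
    orbits. *)
Lemma balance_crit l s : (0 < l < r)%N -> l <> i -> balance (bet T l, s) = 0.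
Proof.
case/andP=> l0 lr li; case: s.
  rewrite (@balance_in_branch (Ordinal lr)); last first.
    by rewrite /in_branch /= lexx (hT.1 (Ordinal lr)).
  rewrite /balancel.
  have H s : right_countl s (Ordinal lr) (bet T l, true) = visits s (Ordinal lr).
    apply: eq_bigr => k _; congr nat_of_bool; case h: in_branch => //=.
    rewrite /right_of /= lt_neqAle; apply/andP; split.
      by rewrite eq_sym; apply/eqP => e; apply: li; apply: orb_crit (ltnW lr) e.
    by move: h; rewrite /in_branch; case: ifP => _ /andP[] // /ltW.
  by rewrite !H hv subrr.
have lr' : (l.-1 < r)%N by lia.
have el : (Ordinal lr').+1 = l by rewrite /= prednK.
rewrite (@balance_in_branch (Ordinal lr')); last first.
  by have := hT.1 (Ordinal lr'); rewrite /in_branch el /= lexx andbT.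
rewrite /balancel.
have H s : right_countl s (Ordinal lr') (bet T l, false) = 0%N.
  apply: big1 => k _; apply/eqP; rewrite eqb0; apply/negP => /andP[].
  rewrite /right_of /in_branch el => h1 /= h2; apply/li/(@orb_crit l s k (ltnW lr)).
  by apply/eqP; rewrite eq_le h2 andbT; move: h1; case: ifP => _ /andP[_] // /ltW.
by rewrite !H.
Qed.

(** Suppose [w] reaches another breakpoint; its balance is then 0. The orbit point nearest to [w] on
    the side of [z] is interior to the component, so its germ facing [w] has nonzero balance, yet no
    orbit point lies between to change the value. *)
Lemma component_class x y z s n w t n' l : component T x y -> x < z < y ->
  (iter n f (z, s)).1 = bet T i -> spoints x y (w, t) -> (0 < l < r)%N ->
  (iter n' f (w, t)).1 = bet T l -> l = i.
Proof.
move=> c hz ez hw hl ew; apply: contrapT => li.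
have inside q s' : x < q < y -> per (q, s').
  case/andP=> xq qy; apply: (spoints_per r0 hT hN c); rewrite /spoints /=.
  by case: s'; rewrite ?xq ?qy ?ltW.
have pw := spoints_per r0 hT hN c hw.
have bw : balance (w, t) = 0.
  rewrite -(balance_iter n' pw) [iter _ _ _]surjective_pairing ew.
  exact: balance_crit.
have nw s' k : (orb s' k).1 != w.
  apply/eqP => e; apply: li; apply: (class_uniq (N := N) hg hi); first by case/andP: hl => _ /ltnW.
  apply: (cong_trans (y := w)).
    by rewrite -e; apply/cong_sym/orb_cong.
  by rewrite -ew; apply/cong_sym/(cong_iter (w, t) n' hN).
have [k0 ek0] : exists k, (orb s k).1 = z.
  have en : iter n f (z, s) = (bet T i, s) by rewrite [LHS]surjective_pairing iter_sign ez.
  by have [k ek] := per_reach (inside z s hz) en; exists k; rewrite /orb ek.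
have kM : (k0 %% M < M)%N by rewrite ltn_mod fact_gt0.
pose F (p : bool * 'I_M) := (orb p.1 p.2).1.
pose p0 : bool * 'I_M := (s, Ordinal kM).
have F0 : F p0 = z by rewrite /F /= -orb_mod.
have zw : z != w by rewrite -ek0 nw.
have [xz zy] := andP hz.
have [xw wy] : x <= w /\ w <= y.
  by move: hw; rewrite /spoints /=; case: t {ew pw bw} => /andP[? ?]; split; lra.
move: zw; rewrite neq_lt => /orP[zw|wz].
  (* [F p] is the rightmost orbit point to the left of [w]; [p0], which gives [z], shows that there
     is one. *)
  case: (@arg_maxP _ _ _ p0 (fun p => F p < w) F) => [|p Fp pmax].
    by rewrite F0.
  have zq : z <= F p by rewrite -F0; apply: pmax; rewrite F0.
  have /negP[] : balance (F p, true) != 0.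
    apply: balance_orb; first by exists p.1, p.2.
    by apply: inside; apply/andP; split; lra.
  have H s' (k : 'I_M) : right_of (orb s' k).1 (F p, true) = right_of (orb s' k).1 (w, t).
    have := nw s' k; rewrite neq_lt /right_of /= => /orP[h|h].
      have hF : (orb s' k).1 <= F p by apply: (pmax (s', k)).
      by case: t {hw ew pw bw}; apply/idP/idP => ?; lra.
    by case: t {hw ew pw bw}; apply/idP/idP => ?; lra.
  by rewrite -bw; apply/eqP; congr (_ - _); congr Posz;
    apply: eq_bigr => k _; rewrite H.
case: (@arg_minP _ _ _ p0 (fun p => w < F p) F) => [|p Fp pmin].
  by rewrite F0.
have qz : F p <= z by rewrite -F0; apply: pmin; rewrite F0.
have /negP[] : balance (F p, false) != 0.
  apply: balance_orb; first by exists p.1, p.2.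
  by apply: inside; apply/andP; split; lra.
have H s' (k : 'I_M) : right_of (orb s' k).1 (F p, false) = right_of (orb s' k).1 (w, t).
  have := nw s' k; rewrite neq_lt /right_of /= => /orP[h|h].
    by case: t {hw ew pw bw}; apply/idP/idP => ?; lra.
  have hF : F p <= (orb s' k).1 by apply: (pmin (s', k)).
  by case: t {hw ew pw bw}; apply/idP/idP => ?; lra.
by rewrite -bw; apply/eqP; congr (_ - _); congr Posz;
  apply: eq_bigr => k _; rewrite H.
Qed.

End Balance.

(** * Balanced maps satisfy ACC and Matching *)

Definition balanced (R : realType) (r : nat) (T : param R r) (N : nat) :=
  forall i, (0 < i < r)%N -> (forall s, per T N (bet T i, s)) ->
    visits T N i false = visits T N i true.

Section Balanced.
Context (R : realType) (r : nat) (T : param R r) (N : nat).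
Context (r0 : (0 < r)%N) (hT : ITM T) (hN : ratgam T N) (hg : generic T).
Context (hb : balanced T N).
Local Notation f := (sitm T).
Local Notation per := (per T N).

Lemma iter_pair a n x : (iter n f a).1 = x -> iter n f a = (x, a.2).
Proof. by move=> <-; rewrite [LHS]surjective_pairing iter_sign. Qed.

(** Both germs at [z] travel together to the breakpoint, so both are periodic all along and every
    passage through the component is interior by [component_interior]. The last passage is [a]. *)
Lemma last_passage x y : component T x y -> ~ dyn_trivial T x y ->
  exists a i n, [/\ x < a < y, (0 < i < r)%N &
    forall s, iter n f (a, s) = (bet T i, s) /\
    forall k, (0 < k <= n)%N -> ~ spoints x y (iter k f (a, s))].
Proof.
move=> c /existsNP[z /existsNP[s /existsNP[m /not_implyP[hz /contrapT[i ir ei]]]]].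
have inner q s' : x < q < y -> spoints x y (q, s').
  by case/andP=> xq qy; rewrite /spoints /=; case: s'; rewrite ?xq ?qy ?ltW.
have innerP q s' : x < q < y -> per (q, s').
  by move=> h; apply: (spoints_per r0 hT hN c); apply: inner.
have vz : valid (z, s) by apply: per_valid (innerP _ _ hz).
have [n _ [en tog]] := together r0 hT hN hg ir vz ei.
have pf k : (k <= n)%N -> forall s', per ((iter k f (z, s)).1, s').
  move=> kn s'; have [<-|ne] := eqVneq s s'.
    by rewrite -(iter_pair (erefl (iter k f (z, s)).1)); apply: per_iter => //; apply: innerP.
  rewrite (neqb_neg ne).
  have := tog _ kn; rewrite (iter_pair (erefl (iter k f (z, s)).1)) /flip /= => <-.
  by apply: per_iter => //; apply: innerP.
have int k : (k <= n)%N -> forall s', spoints x y ((iter k f (z, s)).1, s') ->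
    x < (iter k f (z, s)).1 < y.
  by move=> kn s'; apply: (component_interior r0 hT hN c); apply: pf.
pose P k := (k <= n)%N && (x < (iter k f (z, s)).1 < y).
have exP : exists k, P k by exists 0%N; rewrite /P leq0n.
have ubP k : P k -> (k <= n)%N by case/andP.
have [k0 /andP[k0n hk0] kmax] := ex_maxnP exP ubP.
set a := (iter k0 f (z, s)).1 in hk0.
have ea : iter k0 f (z, s) = (a, s) by apply: iter_pair.
have ea' : iter k0 f (z, ~~ s) = (a, ~~ s).
  by rewrite -[(z, ~~ s)]/(flip (z, s)) tog // ea.
have shift k s' : (k <= n - k0)%N -> iter k f (a, s') = ((iter (k + k0) f (z, s)).1, s').
  move=> kn; have [<-|ne] := eqVneq s s'.
    by rewrite iterD ea; apply: iter_pair.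
  rewrite (neqb_neg ne).
  rewrite -ea' -iterD -[(z, ~~ s)]/(flip (z, s)) tog; last by lia.
  by rewrite /flip iter_sign.
exists a, i, (n - k0)%N; split => // s'; split.
  by rewrite shift // subnK // en.
move=> k /andP[kp kn]; rewrite shift // => /int h.
have : (k + k0 <= k0)%N by apply: kmax; rewrite /P h ?andbT; lia.
by lia.
Qed.

Lemma return_exists x y a k : (0 < k)%N -> spoints x y (iter k f a) ->
  exists2 k', (k' <= k)%N & is_return_time T x y a k'.
Proof.
move=> k0 hk.
have ex : exists k', (0 < k')%N && `[< spoints x y (iter k' f a) >].
  by exists k; rewrite k0; apply/asboolP.
have [k' /andP[k'0 /asboolP hk'] kmin] := ex_minnP ex.
exists k'; first by apply: kmin; rewrite k0; apply/asboolP.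
split => // j /andP[j0 jk] hj.
have : (k' <= j)%N by apply: kmin; rewrite j0; apply/asboolP.
by lia.
Qed.

(** By [component_class] every landing is at the breakpoint of [a]. Equal landing times give [b = a]
    by injectivity; a shorter one puts [b] on the orbit of [a] after its last passage, and a longer
    one makes [b] return at [a] before landing. *)
Lemma unique_landing x y : component T x y -> ~ dyn_trivial T x y ->
  exists a, [/\ x < a < y, lands_before_return T x y (a, true) &
    forall b s, spoints x y (b, s) -> lands_before_return T x y (b, s) -> b = a].
Proof.
move=> c nt; have [a [i [n [ha ir h]]]] := last_passage c nt.
have ina s : spoints x y (a, s).
  by case/andP: ha => xa ay; rewrite /spoints /=; case: s; rewrite ?xa ?ay ?ltW.
have pa s : per (a, s) by apply: (spoints_per r0 hT hN c).
have pi s : per (bet T i, s) by have [<- _] := h s; apply: per_iter.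
exists a; split => //.
  exists (bet T i, true); last by exists i.
  have [e hk] := h true; exists n => //= k [k0 hk' _].
  by rewrite ltnNge; apply/negP => kn; apply: (hk k) => //; rewrite k0.
move=> b s hs [d [m /= hm <-] [l lr el]].
have il : l = i.
  have [/(congr1 fst) e _] := h true.
  exact: (component_class r0 hT hN hg ir pi (hb ir pi) c ha e hs lr el).
have pb : per (b, s) by apply: (spoints_per r0 hT hN c).
have em : iter m f (b, s) = (bet T i, s) by rewrite -il; apply: iter_pair.
have [en hk] := h s.
case: (ltngtP m n) => mn.
- have : iter m f (iter (n - m) f (a, s)) = iter m f (b, s).
    by rewrite -iterD subnKC ?(ltnW mn) // en em.
  move=> /iter_inj e; have {}e : iter (n - m) f (a, s) = (b, s).
    by apply: (e N) => //; apply: per_iter.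
  by exfalso; apply: (hk (n - m)%N); [lia | rewrite e].
- have : iter n f (iter (m - n) f (b, s)) = iter n f (a, s).
    by rewrite -iterD subnKC ?(ltnW mn) // en em.
  move=> /iter_inj e; have {}e : iter (m - n) f (b, s) = (a, s).
    by apply: (e N) => //; apply: per_iter.
  have mn0 : (0 < m - n)%N by lia.
  have [|k kmn /hm] := @return_exists x y (b, s) _ mn0; first by rewrite e.
  by lia.
- have /iter_inj e : iter n f (b, s) = iter n f (a, s) by rewrite en -mn em.
  by have [] := e N pb (pa s).
Qed.

Lemma A2_balanced : A2 T.
Proof.
move=> x y c /(unique_landing c)[a [/andP[xa ay] _ h]].
have xy := component_lt c.
split=> hl.
  by move: xa; rewrite (h x true) ?ltxx // /spoints /= lexx.
by move: ay; rewrite (h y false) ?ltxx // /spoints /= lexx xy.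
Qed.

Lemma Matching_balanced : Matching T.
Proof.
split=> [|x y c /(unique_landing c)[a [ha hl h]]].
  exact: (finite_type_rational r0 hT hN).
exists a; split=> [|b [/andP[xb yb] [s hs]]]; first by split => //; exists true.
apply/esym/(h _ s) => //; rewrite /spoints /=.
by case: s {hs}; rewrite ?xb ?yb ?ltW.
Qed.

Lemma ACC_balanced : ACC T.
Proof.
split; [exact: (finite_type_rational r0 hT hN)|exact: (A1_generic hN hg)| |].
- exact: A2_balanced.
- exact: (A3_generic r0 hT hN hg).
Qed.

End Balanced.

(** * Perturbing the translations *)

Lemma uniform_pos (R : realType) (I : finType) (P : I -> R -> Prop) :
  (forall i d d', 0 < d' -> d' <= d -> P i d -> P i d') ->
  (forall i, exists2 d, 0 < d & P i d) -> exists2 d, 0 < d & forall i, P i d.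
Proof.
move=> mon H.
have [F hF] : exists F : I -> R, forall i, 0 < F i /\ P i (F i).
  have H' i : exists d, 0 < d /\ P i d by have [d d0 Pd] := H i; exists d.
  have [F hF] := choice H'; by exists F.
have d0 : 0 < \big[Num.min/1]_i F i.
  elim/big_ind: _ => // [x y x0 y0|i _]; first by rewrite lt_min x0.
  by case: (hF i).
exists (\big[Num.min/1]_i F i) => // i.
by apply: (mon i (F i)) => //; [apply: bigmin_le|case: (hF i)].
Qed.

(** After scaling by N, the values are integers shifted by the fractional part [p]. Nonzero ones
    have modulus at least 1 if [p = 0], and at least the minimum of [p] and [1 - p] otherwise. *)
Lemma grid_gap (R : realType) (N : nat) (t : R) : (0 < N)%N ->
  exists2 d, 0 < d & forall k : int, t + k%:~R / N%:R != 0 -> d <= `|t + k%:~R / N%:R|.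
Proof.
move=> N0; have NR : 0 < N%:R :> R by rewrite ltr0n.
pose u := N%:R * t; pose p := u - (Num.floor u)%:~R.
have [p0 p1] : 0 <= p /\ p < 1.
  have := floor_le u; have := floorD1_gt u; rewrite intrD /p; lra.
have E k : t + k%:~R / N%:R = ((Num.floor u + k)%:~R + p) / N%:R.
  rewrite /p intrD; have -> : t = u / N%:R by rewrite /u mulrC mulKf // gt_eqF.
  by rewrite -mulrDl; congr (_ / _); lra.
have H (d : R) : 0 < d -> (forall k : int, k%:~R + p != 0 -> d <= `|k%:~R + p|) ->
    exists2 d, 0 < d & forall k : int, t + k%:~R / N%:R != 0 -> d <= `|t + k%:~R / N%:R|.
  move=> d0 hd; exists (d / N%:R); first by rewrite divr_gt0.
  move=> k; rewrite E mulf_eq0 invr_eq0 (gt_eqF NR) orbF normrM normfV normr_nat => h.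
  by rewrite ler_pM2r ?invr_gt0 // hd.
have [p00|pn0] := eqVneq p 0.
  apply: (H 1) => // k; rewrite p00 addr0 -intr_norm intr_eq0 (_ : 1 = 1%:~R) // ler_int.
  by lia.
have pp : 0 < p by rewrite lt_neqAle eq_sym pn0.
apply: (H (Num.min p (1 - p))); first by rewrite lt_min; lra.
move=> k _; rewrite ge_min; case: (leP 0 k) => k0.
  have : 0 <= k%:~R :> R by rewrite ler0z.
  by move=> h; apply/orP; left; rewrite ger0_norm; lra.
have : k%:~R <= -1 :> R by rewrite (_ : -1 = (-1)%:~R) // ler_int; lia.
by move=> h; apply/orP; right; rewrite ltr0_norm; lra.
Qed.

Definition perturb (R : realType) (r : nat) (T : param R r) (v : 'I_r -> R) : param R r :=
  T + row_mx (\row_l v l) 0.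

Lemma gam_perturb (R : realType) (r : nat) (T : param R r) v l :
  gam (perturb T v) l = gam T l + v l.
Proof. by rewrite /gam /perturb mxE row_mxEl mxE. Qed.

Lemma bet_perturb (R : realType) (r : nat) (T : param R r) v k :
  bet (perturb T v) k = bet T k.
Proof.
case: k => // k; rewrite /bet; case: insubP => // i _ _.
by rewrite /perturb mxE row_mxEr mxE addr0.
Qed.

Lemma in_branch_perturb (R : realType) (r : nat) (T : param R r) v l a :
  in_branch (perturb T v) l a = in_branch T l a.
Proof. by rewrite /in_branch !bet_perturb. Qed.

(** * Shadowing backward orbits of a breakpoint *)

Section Shadow.
Context (R : realType) (r : nat) (T : param R r) (N : nat).
Context (r0 : (0 < r)%N) (hT : ITM T) (hN : ratgam T N) (hg : generic T).
Local Notation f := (sitm T).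
Local Notation per := (per T N).

Lemma class_gap : exists2 d, 0 < d & forall j m z, (0 < j < r)%N -> (m <= r)%N ->
  cong N z (bet T j) -> z <> bet T m -> d <= `|z - bet T m|.
Proof.
have [N0 _] := hN.
have [|[j m]|d d0 hd] := @uniform_pos R ('I_r.+1 * 'I_r.+1)%type (fun jm d =>
  forall k : int, (bet T jm.1 - bet T jm.2) + k%:~R / N%:R != 0 ->
     d <= `|(bet T jm.1 - bet T jm.2) + k%:~R / N%:R|).
- by move=> jm d d' _ dd H k hk; apply: le_trans dd (H k hk).
- exact: grid_gap.
exists d => // j m z /andP[_ jr] mr [k ->] /eqP; rewrite -subr_eq0 addrAC => h.
have jr' : (j < r.+1)%N by lia.
have := hd (Ordinal jr', Ordinal (mr : (m < r.+1)%N)) k; rewrite /= => H.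
by move: (H h); rewrite addrAC.
Qed.

Context (v : 'I_r -> R) (C e d : R) (hC : forall l, `|v l| <= C) (e0 : 0 < e).
Context (hd : forall j m z, (0 < j < r)%N -> (m <= r)%N ->
  cong N z (bet T j) -> z <> bet T m -> d <= `|z - bet T m|).
Context (hed : e * C * N.+1%:R < d).
Local Notation T' := (perturb T (fun l => e * v l)).
Local Notation f' := (sitm T').
Context (hT' : ITM T').

Lemma branch_val_bound a : valid a -> `|branch_val T v a| <= C.
Proof. by move=> /(in_branch_exists hT.1 r0)[l hl]; rewrite (branch_valE hT.1 _ hl). Qed.

(* The last N+1 points of a backward orbit of beta_j under the perturbed map stay
   close to the class of beta_j; by pigeonhole one of them shadows beta_j itself,
   and the side on which it passes beta_j determines the sign of the drift. *)
Lemma shadow o j s : valid o -> (0 < j < r)%N ->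
  iter N.+1 f' o = (bet T j, s) ->
  exists t q, [/\ (0 < q)%N, iter q f (bet T j, t) = (bet T j, t) &
    let W := \sum_(k < q) branch_val T v (iter k f (bet T j, t)) in
    if t then W <= 0 else 0 <= W].
Proof.
move=> vo hj eo; have hedL := hed; set L := N.+1 in eo hedL.
have jr : (j <= r)%N by case/andP: hj => _ /ltnW.
pose a k := iter k f' o.
(* [e * D k] is the drift still to come between times [k] and [L]. Adding it in advance gives points
   [z k] that move by the unperturbed translations, end at the breakpoint and stay within [d] of the
   true orbit by [hed]. *)
pose D k := \sum_(k <= i < L) branch_val T v (a i).
pose z k := (a k).1 + e * D k.
have va k : valid (a k) by apply: valid_iter.
have C0 : 0 <= C by have [l _] := in_branch_exists hT.1 r0 vo; apply: le_trans (hC l).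
have zL : z L = bet T j.
  by rewrite /z /D big_geq // mulr0 addr0 /a eo.
have DS k : (k < L)%N -> D k = branch_val T v (a k) + D k.+1 by move=> kL; rewrite /D big_ltn.
have zS k l : (k < L)%N -> in_branch T l (a k) -> z k.+1 = z k + gam T l.
  move=> kL hl; rewrite /z (DS k kL) (branch_valE hT.1 _ hl) /a iterS -/(a k).
  by rewrite (@sitmE _ _ _ hT'.1 l) ?in_branch_perturb //= gam_perturb; lra.
have zC k : (k <= L)%N -> cong N (z k) (bet T j).
  move=> kL; rewrite -(subKn kL); elim: (L - k)%N => [|i IH].
    by rewrite subn0 zL; apply: cong_refl.
  have [iL|iL] := ltnP i L; last by move: IH; rewrite (_ : L - i = L - i.+1)%N //; lia.
  have [l hl] := in_branch_exists hT.1 r0 (va (L - i.+1)%N).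
  apply: cong_trans IH; rewrite (_ : (L - i = (L - i.+1).+1)%N); last by lia.
  rewrite (zS _ l) //; last by lia.
  have [_ /(_ l)[g ->]] := hN; apply: cong_sym; exists g; by rewrite add0r.
have zD k : (k <= L)%N -> `|z k - (a k).1| < d.
  move=> kL; rewrite /z addrAC subrr add0r normrM (gtr0_norm e0).
  apply: le_lt_trans hedL; rewrite -mulrA ler_pM2l //.
  apply: le_trans (ler_norm_sum _ _ _) _.
  apply: (@le_trans _ _ (\sum_(k <= i < L) C)).
    by apply: ler_sum => i _; apply: branch_val_bound.
  by rewrite sumr_const_nat -[_ *+ _]mulr_natr ler_wpM2l // ler_nat leq_subr.
have zdist k m : (k <= L)%N -> (m <= r)%N -> z k <> bet T m -> d <= `|z k - bet T m|.
  by move=> kL mr; apply: hd hj mr (zC k kL).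
have znb k m : (k <= L)%N -> (m <= r)%N -> z k <> bet T j -> z k <> bet T m.
  move=> kL mr zj zm; apply: zj; rewrite zm; congr (bet T _).
  by apply: (class_uniq (N := N) hg hj mr); apply: cong_sym; rewrite -zm; apply: zC.
(* Away from the j-th breakpoint, [z k] is at least [d] from every breakpoint but less than [d] from
   [a k], so both lie in the same branch. *)
have znear k l t : (k < L)%N -> in_branch T l (a k) -> z k <> bet T j -> in_branch T l (z k, t).
  move=> kL hl zj.
  have h1 := zdist k l (ltnW kL) (ltnW (ltn_ord l)) (znb _ _ (ltnW kL) (ltnW (ltn_ord l)) zj).
  have h2 := zdist k l.+1 (ltnW kL) (ltn_ord l) (znb _ _ (ltnW kL) (ltn_ord l) zj).
  have h3 := zD k (ltnW kL); rewrite ltr_norml in h3.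
  have [h4 h5] : bet T l <= (a k).1 /\ (a k).1 <= bet T l.+1.
    by move: hl; rewrite /in_branch; case: ifP => _ /andP[? ?]; split; lra.
  have d0 : 0 < d by apply: le_lt_trans hedL; rewrite !mulr_ge0 // ltW.
  rewrite ler_normr in h1; rewrite ler_normr in h2.
  case/andP: h3 => h3 h3'.
  have [h6 h7] : bet T l < z k /\ z k < bet T l.+1.
    by case/orP: h1 => h1; case/orP: h2 => h2; split; lra.
  by rewrite /in_branch; case: t; apply/andP; split => /=; lra.
have zstep k l t : (k < L)%N -> in_branch T l (a k) -> in_branch T l (z k, t) ->
    f (z k, t) = (z k.+1, t) /\ branch_val T v (z k, t) = branch_val T v (a k).
  move=> kL hl hz; rewrite (sitmE hT.1 hz) /= (zS k l kL hl); split=> //.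
  by rewrite !(branch_valE hT.1 _ hl) (branch_valE hT.1 _ hz).
(* Otherwise [z] is a genuine orbit of [f] up to time [L]. Its collision among times 0 to N shows
   that the final value, the breakpoint, already occurred one cycle length earlier. *)
have exz : exists k, (k < L)%N && (z k == bet T j).
  apply: contrapT => H.
  have zn k : (k < L)%N -> z k <> bet T j.
    by move=> kL ek; apply: H; exists k; rewrite kL; apply/eqP.
  have zi k : (k <= L)%N -> iter k f (z 0%N, true) = (z k, true).
    elim: k => // k IH kL; rewrite iterS IH ?(ltnW kL) //.
    have [l hl] := in_branch_exists hT.1 r0 (va k).
    by have [] := zstep k l true kL hl (znear _ _ _ kL hl (zn _ kL)).
  have [l hl] := in_branch_exists hT.1 r0 (va 0%N).
  have L0 : (0 < L)%N by [].
  have vz := valid_in_branch hT.1 (znear 0%N l true L0 hl (zn 0%N L0)).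
  have [i [j' [/andP[ij jN] ee]]] := orbit_collision r0 hT hN vz.
  have e1 : iter (L - (j' - i)) f (z 0%N, true) = (z L, true).
    rewrite -(zi L) // (_ : L - (j' - i) = (L - j') + i)%N; last by rewrite /L; lia.
    by rewrite iterD ee -iterD; congr iter; rewrite /L; lia.
  apply: (zn (L - (j' - i))%N); first by rewrite /L; lia.
  by move: e1; rewrite zi ?leq_subr // zL => -[].
have ubz k : (k < L)%N && (z k == bet T j) -> (k <= L)%N by case/andP => /ltnW.
have [k /andP[kL /eqP zk] kmax] := ex_maxnP exz ubz.
have zlater i : (k < i < L)%N -> z i <> bet T j.
  move=> /andP[ki iL] zi; have : (i <= k)%N by apply: kmax; rewrite iL zi eqxx.
  by lia.
have [l hl] := in_branch_exists hT.1 r0 (va k).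
have ak : (a k).1 = bet T j - e * D k by rewrite -zk /z addrK.
have hlr := ltn_ord l.
(* The branch of [a k] must be adjacent to the breakpoint. If it lies to the right, [a k] is not to
   the left of the breakpoint, so the remaining drift is nonpositive; symmetrically on the left. *)
have [t ht tD] : exists2 t, in_branch T l (bet T j, t) & if t then D k <= 0 else 0 <= D k.
  have gap m : (m <= r)%N -> m <> j -> d <= `|bet T j - bet T m|.
    move=> mr mj; apply: (hd hj mr (cong_refl _ _)).
    by move=> /(bet_inj hT.1 jr mr) /esym.
  have [h4 h5] : bet T l <= (a k).1 /\ (a k).1 <= bet T l.+1.
    by move: hl; rewrite /in_branch; case: ifP => _ /andP[? ?]; split; lra.
  have h3 := zD k (ltnW kL); rewrite zk ltr_norml in h3; case/andP: h3 => h3 h3'.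
  have [jl|lj] := leqP j l.
    have lj : l = j :> nat.
      apply: contrapT => lj; have h1 := gap l (ltnW hlr) lj.
      have h2 : bet T j < bet T l by apply: (bet_lt hT.1); lia.
      suff : d < d by rewrite ltxx.
      by rewrite ltr0_norm in h1; lra.
    exists true; first by rewrite /in_branch /= -lj lexx (hT.1 l).
    by rewrite -(pmulr_rle0 _ e0); move: h4; rewrite ak lj; lra.
  have lj' : l.+1 = j :> nat.
    apply: contrapT => lj'; have h1 := gap l.+1 hlr lj'.
    have h2 : bet T l.+1 < bet T j by apply: (bet_lt hT.1); lia.
    suff : d < d by rewrite ltxx.
    by rewrite gtr0_norm in h1; lra.
  exists false; first by rewrite /in_branch /= -lj' lexx (hT.1 l).
  by rewrite -(pmulr_rge0 _ e0); move: h5; rewrite ak lj'; lra.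
have follow i : (i < L - k)%N -> f (z (k + i)%N, t) = (z (k + i).+1, t) /\
    branch_val T v (z (k + i)%N, t) = branch_val T v (a (k + i)%N).
  case: i => [|i] iL; first by rewrite addn0; apply: (zstep k l) => //; rewrite zk.
  have kiL : (k + i.+1 < L)%N by lia.
  have [l' hl'] := in_branch_exists hT.1 r0 (va (k + i.+1)%N).
  by apply: (zstep _ l') => //; apply: znear => //; apply: zlater; lia.
have orbit i : (i <= L - k)%N -> iter i f (bet T j, t) = (z (k + i)%N, t).
  elim: i => [|i IH] iL; first by rewrite addn0 zk.
  by rewrite iterS IH ?(ltnW iL) // addnS; have [] := follow _ iL.
exists t, (L - k)%N; split.
- by rewrite subn_gt0.
- by rewrite orbit // subnKC ?(ltnW kL) // zL.
- have DE : D k = \sum_(0 <= i < L - k) branch_val T v (a (i + k)%N).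
    by rewrite -(big_addn 0 L k xpredT (fun i => branch_val T v (a i))) add0n.
  have -> : \sum_(i < L - k) branch_val T v (iter i f (bet T j, t)) = D k; last exact: tD.
  rewrite DE big_mkord; apply: eq_bigr => i _.
  by rewrite orbit ?(ltnW (ltn_ord i)) // [(i + k)%N]addnC; have [_ <-] := follow _ (ltn_ord i).
Qed.

End Shadow.

(** * Lowering the number of periodic breakpoints *)

Definition periodic_break (R : realType) (r : nat) (T : param R r) (j : nat) :=
  exists s q, (0 < q)%N /\ iter q (sitm T) (bet T j, s) = (bet T j, s).

Definition strict (R : realType) (r : nat) (T : param R r) :=
  forall i : 'I_r, - bet T i < gam T i < 1 - bet T i.+1.

Definition admissible (R : realType) (r : nat) (T : param R r) (N : nat) :=
  [/\ bet_increasing T, strict T, ratgam T N & generic T].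

Lemma strict_ITM (R : realType) (r : nat) (T : param R r) :
  bet_increasing T -> strict T -> ITM T.
Proof. by move=> hm hs; split => // i; have /andP[/ltW -> /ltW ->] := hs i. Qed.

Lemma sum_period (R : realType) (A : Type) (f : A -> A) (F : A -> R) a q c :
  iter q f a = a ->
  \sum_(k < c * q) F (iter k f a) = c%:R * \sum_(k < q) F (iter k f a).
Proof.
move=> e; elim: c => [|c IH]; first by rewrite mul0n big_ord0 mul0r.
rewrite mulSn big_split_ord /= -natr1 mulrDl mul1r addrC -IH; congr (_ + _).
by apply: eq_bigr => k _; rewrite addnC iterD e.
Qed.

Section Descent.
Context (R : realType) (r : nat) (T : param R r) (N : nat).
Context (r0 : (0 < r)%N) (hT : ITM T) (hN : ratgam T N) (hg : generic T).
Local Notation f := (sitm T).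
Local Notation per := (per T N).
Local Notation M := N`!.

Lemma sum_branch_val_visits (v : 'I_r -> R) i s : 
  \sum_(k < M) branch_val T v (orb T i s k) = \sum_l (visits T N i s l)%:R * v l.
Proof.
rewrite exchange_big /=; apply: eq_bigr => l _.
by rewrite /visits natr_sum big_distrl.
Qed.

Lemma sum_visits i s : (0 < i < r)%N -> (\sum_l visits T N i s l = M)%N.
Proof.
move=> hi; rewrite exchange_big /= -[RHS](card_ord M) -sum1_card.
by apply: eq_bigr => k _; rewrite (sum_in_branch r0 hT (orb_valid r0 hT hi s k)).
Qed.

(* Both orbits have M points, so their visit vectors differ only if they are
   not proportional, and then some direction moves the left orbit to the left
   and the right orbit to the right. *)
Lemma repelling_direction i : (0 < i < r)%N -> visits T N i false <> visits T N i true ->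
  exists v : 'I_r -> int,
    \sum_l (visits T N i false l)%:R * (v l)%:~R < 0 :> R /\
    0 < \sum_l (visits T N i true l)%:R * (v l)%:~R :> R.
Proof.
move=> hi hv.
pose a l : int := (visits T N i false l)%:Z; pose b l : int := (visits T N i true l)%:Z.
(* Subtracting [kap] balances the direction: its pairings with [a] and [b] are -M S and M S, where S
   is the sum of the squares of [b l - a l]. Integer entries keep the perturbed translations
   rational. *)
pose kap := \sum_l (a l + b l) * (b l - a l).
pose v l : int := (M.*2)%:Z * (b l - a l) - kap.
have sa : \sum_l a l = M%:Z by rewrite -Posz_sum sum_visits.
have sb : \sum_l b l = M%:Z by rewrite -Posz_sum sum_visits.
have S0 : 0 < \sum_l (b l - a l) ^+ 2.
  rewrite lt_neqAle sumr_ge0 ?andbT; last by move=> l _; apply: sqr_ge0.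
  rewrite eq_sym psumr_eq0; last by move=> l _; apply: sqr_ge0.
  apply/negP => /allP H; apply: hv; apply/funext => l.
  have := H l (mem_index_enum _); rewrite /= sqrf_eq0 subr_eq0 /a /b.
  by move=> /eqP [].
have M0 : 0 < M%:Z by rewrite ltz_nat fact_gt0.
have key (c : 'I_r -> int) : \sum_l c l = M%:Z ->
    \sum_l c l * v l = M%:Z * \sum_l (2 * c l - a l - b l) * (b l - a l).
  move=> sc; transitivity ((M.*2)%:Z * (\sum_l c l * (b l - a l)) - M%:Z * kap).
    rewrite -sc mulr_sumr mulr_suml -sumrB; apply: eq_bigr => l _.
    by rewrite /v; ring.
  have -> : (M.*2)%:Z = M%:Z * 2 by lia.
  rewrite /kap -!mulrA -mulrBr; congr (_ * _).
  by rewrite mulr_sumr -sumrB; apply: eq_bigr => l _; ring.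
exists v; split.
  rewrite (_ : \sum_l _ = (\sum_l a l * v l)%:~R); last first.
    by rewrite rmorph_sum; apply: eq_bigr => l _; rewrite /= intrM.
  rewrite ltrz0 (key _ sa) (_ : \sum_l _ = - \sum_l (b l - a l) ^+ 2); last first.
    by rewrite -sumrN; apply: eq_bigr => l _; ring.
  by rewrite mulrN oppr_lt0 mulr_gt0.
rewrite (_ : \sum_l _ = (\sum_l b l * v l)%:~R); last first.
  by rewrite rmorph_sum; apply: eq_bigr => l _; rewrite /= intrM.
rewrite ltr0z (key _ sb) (_ : \sum_l _ = \sum_l (b l - a l) ^+ 2); last first.
  by apply: eq_bigr => l _; ring.
by rewrite mulr_gt0.
Qed.

Context (v : 'I_r -> R) (C e d : R) (hC : forall l, `|v l| <= C) (e0 : 0 < e).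
Context (hd : forall j m z, (0 < j < r)%N -> (m <= r)%N ->
  cong N z (bet T j) -> z <> bet T m -> d <= `|z - bet T m|).
Context (hed : e * C * N.+1%:R < d).
Local Notation T' := (perturb T (fun l => e * v l)).
Context (hT' : ITM T').

Lemma periodic_break_back j : (0 < j < r)%N -> periodic_break T' j ->
  exists t q, [/\ (0 < q)%N, iter q f (bet T j, t) = (bet T j, t) &
    let W := \sum_(k < q) branch_val T v (iter k f (bet T j, t)) in
    if t then W <= 0 else 0 <= W].
Proof.
move=> hj [s [q [q0 eq]]]; rewrite bet_perturb in eq.
have vb : valid (bet T j, s) by apply: crit_valid.
(* A periodic point has backward orbits of any length: [o] is the point N+1 steps before the end of
   N+1 full periods. *)
pose o := iter (N.+1 * q - N.+1) (sitm T') (bet T j, s).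
apply: (shadow r0 hT hN hg hC e0 hd hed hT' (o := o) (s := s)) => //.
  exact: valid_iter.
rewrite /o -iterD subnKC ?leq_pmulr //; exact: iter_mul_fix.
Qed.

Lemma periodic_break_perturb j : (0 < j < r)%N -> periodic_break T' j -> periodic_break T j.
Proof. by move=> hj /(periodic_break_back hj)[t [q [q0 eq _]]]; exists t, q. Qed.

(** The drifts over q steps and over N! steps along the same cycle are positive multiples of each
    other, so the sign given by shadowing contradicts the sign of the pairing with the visit
    vector. *)
Lemma periodic_break_repelled i : (0 < i < r)%N -> (forall s, per (bet T i, s)) ->
  \sum_l (visits T N i false l)%:R * v l < 0 ->
  0 < \sum_l (visits T N i true l)%:R * v l -> ~ periodic_break T' i.
Proof.
rewrite -!sum_branch_val_visits => hi hp h1 h2 /(periodic_break_back hi)[t [q [q0 eq]]] /=.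
have E := sum_period (branch_val T v) M eq.
have E' := sum_period (branch_val T v) q (hp t).2.
rewrite mulnC E in E'.
have M0 : 0 < M%:R :> R by rewrite ltr0n fact_gt0.
have Q0 : 0 < q%:R :> R by rewrite ltr0n.
case: t eq E E' => eq E E' W.
  have : M%:R * (\sum_(k < q) branch_val T v (iter k f (bet T i, true))) <= 0.
    by rewrite pmulr_rle0.
  by rewrite E' pmulr_rle0 // leNgt h2.
have : 0 <= M%:R * (\sum_(k < q) branch_val T v (iter k f (bet T i, false))).
  by rewrite pmulr_rge0.
by rewrite E' pmulr_rge0 // leNgt h1.
Qed.

End Descent.

Lemma nbhs_param (R : realType) (r : nat) (T : param R r) (U : set (param R r)) :
  nbhs T U -> exists2 e, 0 < e &
    forall T' : param R r, (forall j, `|T' ord0 j - T ord0 j| < e) -> U T'.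
Proof.
move=> /nbhs_ballP[e /= e0 he]; exists e => // T' hT'; apply: he; split=> // i j /=.
by rewrite (ord1 i) /ball /= distrC.
Qed.

Definition num_periodic_breaks (R : realType) (r : nat) (T : param R r) : nat :=
  #|[pred j : 'I_r | (0 < j)%N && `[< periodic_break T j >]]|.

Lemma descent_step (R : realType) (r : nat) (T : param R r) (N : nat)
    (U : set (param R r)) : (0 < r)%N -> nbhs T U -> admissible T N ->
  ~ balanced T N ->
  exists T' N', [/\ U T', admissible T' N' & (num_periodic_breaks T' < num_periodic_breaks T)%N].
Proof.
move=> r0 hU [hm hs hN hg] /existsNP[i /not_implyP[hi /not_implyP[hp hv]]].
have hT := strict_ITM hm hs.
have [v [hv1 hv2]] := repelling_direction r0 hT hi hv.
have [C hC] : exists C : R, forall l, `|(v l)%:~R| <= C.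
  exists (\sum_l `|(v l)%:~R|) => l; rewrite (bigD1 l) //= lerDl.
  by apply: sumr_ge0 => m _.
have C0 : 0 <= C by apply: le_trans (hC (Ordinal r0)).
have [d d0 hd] := class_gap r0 hN.
have [e1 e10 he1] := nbhs_param hU.
have [e2 e20 he2] : exists2 e, 0 < e & forall l : 'I_r,
    - bet T l + e <= gam T l <= 1 - bet T l.+1 - e.
  apply: (@uniform_pos R 'I_r (fun (l : 'I_r) (e : R) => - bet T l + e <= gam T l <= 1 - bet T l.+1 - e)).
    by move=> l x y y0 yx /andP[? ?]; apply/andP; split; lra.
  move=> l; have /andP[h1 h2] := hs l.
  exists (Num.min (gam T l + bet T l) (1 - bet T l.+1 - gam T l)).
    by rewrite lt_min; apply/andP; split; lra.
  by case: (leP (gam T l + bet T l)) => ?; apply/andP; split; lra.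
have [N0 hgam] := hN.
(* [B] dominates both the entries of [v] and [C * N.+1]; the added 1 keeps it positive. The scale is
   an inverse integer so that [N * K] is a common denominator for the new translations. *)
pose B := (C + 1) * N.+1%:R.
have B0 : 0 < B by rewrite mulr_gt0 // ltr_wpDl.
have [K K0 hK] : exists2 K, (0 < K)%N & K%:R^-1 * B < Num.min d (Num.min e1 e2).
  have m0 : 0 < Num.min d (Num.min e1 e2) by rewrite !lt_min d0 e10.
  pose x := B / Num.min d (Num.min e1 e2).
  have x0 : 0 <= x by rewrite divr_ge0 // ltW.
  exists (Num.bound x).+1 => //.
  rewrite mulrC ltr_pdivrMr ?ltr0n // mulrC -ltr_pdivrMr // -/x.
  by apply: lt_le_trans (archi_boundP x0) _; rewrite ler_nat.
have KR : 0 < K%:R^-1 :> R by rewrite invr_gt0 ltr0n.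
have small l : `|K%:R^-1 * (v l)%:~R| < Num.min d (Num.min e1 e2).
  apply: le_lt_trans hK; rewrite normrM (gtr0_norm KR) ler_pM2l //.
  apply: le_trans (hC l) _; rewrite /B mulrDl mul1r.
  by apply: ler_wpDr => //; rewrite ler_peMr // ler1n.
have hed : K%:R^-1 * C * N.+1%:R < d.
  have : K%:R^-1 * B < d by apply: lt_le_trans hK _; rewrite ge_min lexx.
  apply: le_lt_trans; rewrite -mulrA ler_pM2l // /B ler_pM2r ?ltr0n //.
  by rewrite lerDl.
pose T' := perturb T (fun l => K%:R^-1 * (v l)%:~R).
have hm' : bet_increasing T' by move=> l; rewrite !bet_perturb; apply: hm.
have hs' : strict T'.
  move=> l; rewrite !bet_perturb gam_perturb.
  have : `|K%:R^-1 * (v l)%:~R| < e2.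
    by apply: lt_le_trans (small l) _; rewrite !ge_min lexx !orbT.
  rewrite ltr_norml => /andP[h1 h2]; have /andP[h3 h4] := he2 l.
  by apply/andP; split; lra.
have hT' := strict_ITM hm' hs'.
exists T', (N * K)%N; split.
- apply: he1 => j; rewrite /T' /perturb mxE addrAC subrr add0r.
  case: (split_ordP j) => l ->; last by rewrite row_mxEr mxE normr0.
  rewrite row_mxEl mxE; apply: lt_le_trans (small l) _.
  by rewrite !ge_min lexx !orbT.
- split => //.
    split; first by rewrite muln_gt0 N0.
    move=> l; rewrite gam_perturb; have [k ->] := hgam l.
    exists (k * K%:Z + v l * N%:Z); rewrite !add0r natrM intrD !intrM.
    have KR' : K%:R != 0 :> R by rewrite pnatr_eq0 -lt0n.
    have NR' : N%:R != 0 :> R by rewrite pnatr_eq0 -lt0n.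
    by field; rewrite KR' NR'.
  by move=> j m hj mr mj; rewrite !bet_perturb; apply: hg.
have ir : (i < r)%N by case/andP: hi.
apply/proper_card/properP; split.
  apply/fintype.subsetP => j; rewrite !inE => /andP[j0 /asboolP hj].
  rewrite j0; apply/asboolP.
  by apply: (periodic_break_perturb r0 hT hN hg hC KR hd hed hT') hj; rewrite j0 ltn_ord.
exists (Ordinal ir); rewrite !inE /=.
  case/andP: hi => -> _; apply/asboolP; exists true, N`!.
  by rewrite fact_gt0; split => //; case: (hp true).
rewrite negb_and; apply/orP; right; apply/asboolP.
exact: (periodic_break_repelled r0 hT hN hg hC KR hd hed hT' hi hp hv1 hv2).
Qed.

Lemma balanced_nearby (R : realType) (r : nat) (T : param R r) (N : nat)
    (U : set (param R r)) : (0 < r)%N -> open U -> U T -> admissible T N ->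
  exists T' N', [/\ U T', admissible T' N' & balanced T' N'].
Proof.
move=> r0 oU; have [n] := ubnP (num_periodic_breaks T); elim: n T N => // n IH T N hn UT aT.
have [hb|nb] := pselect (balanced T N); first by exists T, N.
have hU : nbhs T U by apply: open_nbhs_nbhs.
have [T' [N' [UT' aT' lt]]] := descent_step r0 hU aT nb.
apply: (IH T' N') => //; exact: leq_trans lt _.
Qed.

(** * Approximation by rational translations *)

Lemma rat_near (R : realType) (a b : R) : a < b -> exists q : rat, a < ratr q < b.
Proof.
by move=> /rat_in_itvoo[q]; rewrite in_itv /= => h; exists q.
Qed.

Lemma common_denominator (R : realType) (I : finType) (q : I -> rat) :
  exists2 N : nat, (0 < N)%N & forall i, cong N (ratr (q i) : R) 0.
Proof.
exists (\prod_i `|denq (q i)|)%N.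
  by apply: prodn_gt0 => i; rewrite absz_gt0 denq_neq0.
move=> i; pose P := (\prod_(j | j != i) `|denq (q j)|)%N.
rewrite (bigD1 i) //= -/P; exists (numq (q i) * P%:Z).
rewrite add0r natrM intrM -[in LHS](divq_num_den (q i)).
rewrite fmorph_div /= !ratr_int.
have dE : (denq (q i))%:~R = `|denq (q i)|%N%:R :> R.
  by rewrite -[in LHS](gez0_abs (ltW (denq_gt0 _))).
have d0 : `|denq (q i)|%N%:R != 0 :> R by rewrite pnatr_eq0 absz_eq0 denq_neq0.
have p0 : P%:R != 0 :> R.
  rewrite pnatr_eq0 -lt0n; apply: prodn_gt0 => j; by rewrite absz_gt0 denq_neq0.
by rewrite dE; field; rewrite d0 p0.
Qed.

Lemma pi_combination (R : realType) (c : int) (q : rat) :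
  c != 0 -> irrational (ratr q + c%:~R * pi : R).
Proof.
move=> c0 [p _ e]; apply: (@pi_irrationnal R).
have cR : c%:~R != 0 :> R by rewrite intr_eq0.
exists ((p - q) / c%:~R) => //.
rewrite fmorph_div /= rmorphB /= e ratr_int addrC addKr mulrC mulKf //.
Qed.

Lemma admissible_nearby (R : realType) (r : nat) (T : param R r)
    (U : set (param R r)) : (2 <= r)%N -> ITM T -> nbhs T U ->
  exists T' N, U T' /\ admissible T' N.
Proof.
move=> r2 [hm hT] /nbhs_param[e e0 he].
have [d d0 hd] : exists2 d, 0 < d & forall i : 'I_r, d <= bet T i.+1 - bet T i.
  apply: (@uniform_pos R 'I_r (fun (i : 'I_r) (d : R) => d <= bet T i.+1 - bet T i)).
    by move=> i x y _ yx; apply: le_trans.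
  by move=> i; exists (bet T i.+1 - bet T i); rewrite // subr_gt0.
(* Moving breakpoints by less than [d / 2] preserves their order, as consecutive ones are at least
   [d] apart. *)
pose w := Num.min e (d / 2).
have w0 : 0 < w by rewrite lt_min e0 divr_gt0.
have we : w <= e by rewrite ge_min lexx.
have wd : w <= d / 2 by rewrite ge_min lexx orbT.
(* The k-th breakpoint is approximated by a rational plus k times pi. Distinct multiples of pi make
   the differences irrational; the endpoints 0 and 1 have multiple 0. *)
have [q hq] : exists q : nat -> rat, forall k, `|ratr (q k) + k%:R * pi - bet T k| < w.
  have H k : exists q : rat, `|ratr q + k%:R * pi - bet T k| < w.
    have [|q /andP[q1 q2]] := @rat_near R (bet T k - k%:R * pi - w) (bet T k - k%:R * pi + w).
      by lra.
    by exists q; rewrite ltr_norml; apply/andP; split; lra.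
  by have [q hq] := choice H; exists q.
pose b (k : nat) : R := if k == 0%N then 0 else if (k < r)%N then ratr (q k) + k%:R * pi else 1.
have hb k : (k <= r)%N -> `|b k - bet T k| < w.
  rewrite /b; case: eqP => [-> _|_]; first by rewrite bet_first subrr normr0.
  case: ltnP => // h1 h2; have -> : k = r by lia.
  by rewrite bet_last ?subrr ?normr0 //; lia.
have bS (i : 'I_r) : b i < b i.+1.
  have h1 := hb i (ltnW (ltn_ord i)); have h2 := hb i.+1 (ltn_ord i); have h3 := hd i.
  by rewrite ltr_norml in h1; rewrite ltr_norml in h2; lra.
have b1 : b r = 1 by rewrite /b ltnn; case: eqP => // h; lia.
have b0 : b 0%N = 0 by rewrite /b.
(* With at least two branches each is shorter than 1, so the interval of allowed translations has
   nonempty interior and a strict rational choice exists. *)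
have bgap (i : 'I_r) : b i.+1 - b i < 1.
  have mono m n : (m <= n <= r)%N -> b m <= b n.
    elim: n => [|n IH]; first by rewrite leqn0 => /andP[/eqP ->].
    case/andP; rewrite leq_eqVlt => /orP[/eqP -> //|]; rewrite ltnS => mn nr.
    by apply: le_trans (IH _) (ltW (bS (Ordinal nr))); rewrite mn ltnW.
  have [i0|i0] := posnP i.
    have i1 : (1 < r)%N by lia.
    have := bS (Ordinal i1); have := mono 2 r; rewrite b1 r2 leqnn => /(_ isT).
    by rewrite i0 /= b0; lra.
  have r0 : (0 < r)%N by lia.
  have := bS (Ordinal r0); have := mono 1%N i; have := mono i.+1 r.
  rewrite b1 i0 (ltn_ord i) leqnn (ltnW (ltn_ord i)) => /(_ isT) h1 /(_ isT) h2.
  by rewrite /= b0; lra.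
have [g hg] : exists g : 'I_r -> rat, forall i : 'I_r,
    (- b i < ratr (g i) < 1 - b i.+1) /\ `|ratr (g i) - gam T i| < e.
  have H (i : 'I_r) : exists g : rat, (- b i < ratr g < 1 - b i.+1) /\ `|ratr g - gam T i| < e.
    have [|p] := @rat_near R (Num.max (- b i) (gam T i - e)) (Num.min (1 - b i.+1) (gam T i + e)).
      have h1 := hb i (ltnW (ltn_ord i)); have h2 := hb i.+1 (ltn_ord i).
      rewrite ltr_norml in h1; rewrite ltr_norml in h2.
      have h3 := bgap i; have /andP[h4 h5] := hT i.
      by rewrite gt_max !lt_min; apply/andP; split; apply/andP; split; lra.
    rewrite gt_max lt_min => /andP[/andP[p1 p2] /andP[p3 p4]].
    by exists p; rewrite p1 p3 ltr_norml; split => //; apply/andP; split; lra.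
  by have [g hg] := choice H; exists g.
have [N N0 hN] := common_denominator R g.
pose T' : param R r := row_mx (\row_i ratr (g i)) (\row_j b j.+1).
have gT' i : gam T' i = ratr (g i) by rewrite /gam /T' row_mxEl mxE.
have bT' k : (k <= r)%N -> bet T' k = b k.
  case: k => [|k] kr; first by rewrite bet_first.
  rewrite /bet; case: insubP => [i _ <-|]; first by rewrite /T' row_mxEr mxE.
  by move=> h; have -> : k.+1 = r by [lia]; rewrite b1.
exists T', N; split.
  apply: he => j; case: (split_ordP j) => i ->.
    by rewrite /T' row_mxEl mxE; case: (hg i).
  rewrite /T' row_mxEr mxE; apply: lt_le_trans we.
  have ir : (i.+1 <= r)%N by have := ltn_ord i; lia.
  have := hb _ ir; rewrite /bet; case: insubP => [i' _ e'|]; last by rewrite ltn_ord.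
  by rewrite (val_inj e').
split.
- by move=> i; rewrite !bT' ?(ltnW (ltn_ord i)).
- by move=> i; rewrite !bT' ?(ltnW (ltn_ord i)) // gT'; case: (hg i).
- by split => // l; rewrite gT'.
move=> j m /andP[j0 jr] mr mj; rewrite !bT' ?(ltnW jr) //.
rewrite {1}/b jr (gtn_eqF j0).
have [p [c [-> cj]]] : exists (p : rat) (c : int), b m = ratr p + c%:~R * pi /\ c != j%:Z.
  rewrite /b; case: eqP => m0; first by exists 0, 0; rewrite rmorph0 mul0r addr0; split => //; lia.
  case: ifP => h; first by exists (q m), m%:Z; split => //; lia.
  by exists 1, 0; rewrite rmorph1 mul0r addr0; split => //; lia.
have -> : ratr (q j) + j%:R * pi - (ratr p + c%:~R * pi) =
    ratr (q j - p) + (j%:Z - c)%:~R * pi :> R.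
  by rewrite rmorphB /= intrB; ring.
by apply: pi_combination; rewrite subr_eq0 eq_sym.
Qed.

(* A neighbourhood of T in ITM(r) is the trace on ITM(r) of a neighbourhood U
   of T in R^(2r-1). *)
Theorem theorem4p1 (R : realType) (r : nat) (hr : (2 <= r)%N)
    (T : 'rV[R]_(r + r.-1)) (hT : @ITM R r T) (hper : @eventually_periodic R r T)
    (U : set 'rV[R]_(r + r.-1)) (hU : nbhs T U) :
  exists T' : 'rV[R]_(r + r.-1),
    [/\ U T', @ITM R r T', @finite_type R r T', @ACC R r T' & @Matching R r T'].
Proof.
have r0 : (0 < r)%N by apply: leq_trans hr.
(* The descent perturbs repeatedly, so it runs inside an open set, which is a neighbourhood of each
   of the successive maps. *)
have oU : open (U°) by apply: open_interior.
have hU' : nbhs T (U°) by apply: open_nbhs_nbhs; split => //; apply: nbhs_interior.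
have [T1 [N1 [UT1 aT1]]] := admissible_nearby hr hT hU'.
have [T' [N [UT' [hm hs hN hg] hb]]] := balanced_nearby r0 oU UT1 aT1.
have hT' := strict_ITM hm hs.
exists T'; split => //.
- exact: interior_subset UT'.
- exact: (finite_type_rational r0 hT' hN).
- exact: (ACC_balanced r0 hT' hN hg hb).
- exact: (Matching_balanced r0 hT' hN hg hb).
Qed.
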